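(* Let $\{G_n\}_{n=1}^{\infty}$ be a sequence of finite simple graphs such that $|E(G_n)|$ increases with $n$ and $\Delta(G_n)^2=o(|E(G_n)|)$ as $n\to\infty$. Then the Laplacian coefficients $c(G_n,k)$ are asymptotically normal (by central and local limit theorems).
   Context: For a finite simple graph $G$ with $N$ vertices, let $L(G)=D(G)-A(G)$ be its Laplacian matrix ($D(G)$ the diagonal degree matrix, $A(G)$ the adjacency matrix), and write its characteristic polynomial as $\det(xI-L(G))=\sum_{k=0}^{N}(-1)^{N-k}c(G,k)x^k$; the numbers $c(G,k)\ge 0$ are the Laplacian coefficients. $\Delta(G)$ denotes the maximum vertex degree and $E(G)$ the edge set. For the sequence $G_n$ with $N_n=|V(G_n)|$, let $p(n,k)=c(G_n,k)/\sum_{j=0}^{N_n}c(G_n,j)$ for $0\le k\le N_n$, and let $\mu_n$ and $\sigma_n^2$ be the mean and variance of the probability distribution $(p(n,k))_k$. The coefficients are asymptotically normal by a central limit theorem if $\lim_{n\to\infty}\sup_{x\in\mathbb{R}}\left|\sum_{k\le \mu_n+x\sigma_n}p(n,k)-\frac{1}{\sqrt{2\pi}}\int_{-\infty}^x e^{-t^2/2}dt\right|=0$, and by a local limit theorem if $\lim_{n\to\infty}\sup_{x\in\mathbb{R}}\left|\sigma_n p(n,\lfloor\mu_n+x\sigma_n\rfloor)-\frac{1}{\sqrt{2\pi}}e^{-x^2/2}\right|=0$. *)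

(* Defs.v *)
From HB Require Import structures.
From mathcomp Require Import all_boot all_order all_algebra.
From mathcomp Require Import all_classical all_reals all_analysis.
Set Implicit Arguments. Unset Strict Implicit. Unset Printing Implicit Defensive.
Import Order.TTheory GRing.Theory Num.Theory.
Local Open Scope ring_scope.
Local Open Scope classical_set_scope.

Record sgraph := SGraph {
  nv : nat;
  adj : rel 'I_nv;
  adj_sym : forall i j, adj i j = adj j i;
  adj_irr : forall i, adj i i = false }.

Arguments adj : clear implicits.
Definition deg (G : sgraph) (i : 'I_(nv G)) : nat := #|[set j | adj G i j]|.

Definition maxdeg (G : sgraph) : nat := (\max_(i : 'I_(nv G)) deg i)%N.

Definition nedges (G : sgraph) : nat :=
  #|[set p : 'I_(nv G) * 'I_(nv G) | (p.1 < p.2)%N && adj G p.1 p.2]|.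

Definition degmx (R : nzRingType) (G : sgraph) : 'M[R]_(nv G) :=
  \matrix_(i, j) (if i == j then (deg i)%:R else 0).
Definition adjmx (R : nzRingType) (G : sgraph) : 'M[R]_(nv G) :=
  \matrix_(i, j) (if adj G i j then 1 else 0).
Definition laplacian (R : nzRingType) (G : sgraph) : 'M[R]_(nv G) :=
  degmx R G - adjmx R G.

(* det(xI - L) = sum_k (-1)^(N-k) c(G,k) x^k ; c(G,k) = 0 for k > N *)
Definition lapcoef (R : comNzRingType) (G : sgraph) (k : nat) : R :=
  (-1) ^+ (nv G - k) * (char_poly (laplacian R G))`_k.

Section Distr.
Variable R : realType.
Variable G : nat -> sgraph.

Definition lapsum (n : nat) : R := \sum_(j < (nv (G n)).+1) lapcoef R (G n) j.

(* p(n,k) for 0 <= k <= N_n (and 0 for k > N_n) *)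
Definition pnk (n k : nat) : R := lapcoef R (G n) k / lapsum n.

Definition mu (n : nat) : R := \sum_(k < (nv (G n)).+1) k%:R * pnk n k.
Definition sigma2 (n : nat) : R :=
  \sum_(k < (nv (G n)).+1) (k%:R - mu n) ^+ 2 * pnk n k.
Definition sigma (n : nat) : R := Num.sqrt (sigma2 n).

Definition pnz (n : nat) (z : int) : R :=
  if (0 <= z)%R then pnk n `|z|%N else 0.
End Distr.

Definition Phi (R : realType) (x : R) : R :=
  (Num.sqrt (pi *+ 2))^-1 *
  Rintegral (@lebesgue_measure R) `]-oo, x] (fun t => expR (- (t ^+ 2) / 2)).

Definition clt_normal (R : realType) (G : nat -> sgraph) : Prop :=
  forall eps : R, 0 < eps -> \forall n \near \oo, forall x : R,
    `| \sum_(k < (nv (G n)).+1 | k%:R <= mu R G n + x * sigma R G n) pnk R G n k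
       - Phi x | <= eps.

Definition llt_normal (R : realType) (G : nat -> sgraph) : Prop :=
  forall eps : R, 0 < eps -> \forall n \near \oo, forall x : R,
    `| sigma R G n * pnz R G n (Num.floor (mu R G n + x * sigma R G n))
       - (Num.sqrt (pi *+ 2))^-1 * expR (- (x ^+ 2) / 2) | <= eps.

(* Main.v *)
(** The Laplacian eigenvalues [l] are real and lie in [[0, 2 Delta]], so the
    normalized coefficients are the law of a sum of independent Bernoulli
    variables of parameters [1 / (1 + l)], whose variance [V] is at least
    [|E| / (1 + 2 Delta)^2], hence tends to infinity.

    Write [a k] for this law, [mu] for its mean, and [S m] for the tail sum of
    [(k - mu) a k] over [k >= m].  Log-concavity bounds the total variation of
    one half of the sum by twice its maximum, of order [V^(-1/2)]; convolving it
    with the other half bounds the increments of [a] by [O(1 / V)], and from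
    this [V a m = S m + O(1)].  With [h = V^(-1/2)] and [x m = (m - mu) h], the
    identity [S m - S (m+1) = (m - mu) a m] then becomes an Euler scheme for
    [u' = - x u]: [h S m exp (x m ^ 2 / 2)] varies by [O(h ^ 2)] per step, so
    [a m] is [h B] times the Gaussian density up to [O(h ^ 2)] on every bounded
    window.  Chebyshev's inequality forces the constant [B] to be close to [1],
    and controls what lies outside of the window; the local tails follow from
    [|m - mu| a m = O(1)]. *)

Require Import Defs.
From HB Require Import structures.
From mathcomp Require Import all_boot all_order all_algebra.
From mathcomp Require Import all_classical all_reals all_analysis.
From mathcomp Require Import measurable_realfun complex.
From mathcomp Require Import ring lra.
Import Order.TTheory GRing.Theory Num.Theory.
Import numFieldNormedType.Exports.
Set Implicit Arguments. Unset Strict Implicit. Unset Printing Implicit Defensive.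
Local Open Scope classical_set_scope.
Local Open Scope ring_scope.

(** * Generating polynomials of sums of independent Bernoulli variables, and their Stein identity *)

Section PoissonBinomial.
Variable R : rcfType.
Implicit Types (w : R) (s t : seq R) (p q : {poly R}) (m k : nat).

Definition bernoulli_poly w : {poly R} := 1 - w%:P + w%:P * 'X.

Definition pbin_poly s : {poly R} := \prod_(w <- s) bernoulli_poly w.

Definition pbin_mean s : R := \sum_(w <- s) w.

Definition pbin_var s : R := \sum_(w <- s) w * (1 - w).

(* The sum over [w] in [s] of [w (1 - w)] times the law of the sum without [w],
   as a recursion that avoids removing elements from a list. *)
Fixpoint stein_poly s : {poly R} :=
  if s is w :: s' then
    (w%:P * (1 - w%:P)) * pbin_poly s' + bernoulli_poly w * stein_poly s'
  else 0.

Definition prob_seq s : bool := all (fun w => 0 <= w <= 1) s.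

Lemma pbin_poly_cons w s : pbin_poly (w :: s) = bernoulli_poly w * pbin_poly s.
Proof. by rewrite /pbin_poly big_cons. Qed.

Lemma pbin_poly_cat s t : pbin_poly (s ++ t) = pbin_poly s * pbin_poly t.
Proof. by rewrite /pbin_poly big_cat. Qed.

Lemma pbin_var_cons w s : pbin_var (w :: s) = w * (1 - w) + pbin_var s.
Proof. by rewrite /pbin_var big_cons. Qed.

Lemma pbin_var_cat s t : pbin_var (s ++ t) = pbin_var s + pbin_var t.
Proof. by rewrite /pbin_var big_cat. Qed.

Lemma pbin_var_ge0 s : prob_seq s -> 0 <= pbin_var s.
Proof.
elim: s => [|w s IHs] /=; first by rewrite /pbin_var big_nil.
case/andP=> /andP[w0 w1] /IHs s0; rewrite pbin_var_cons.
by rewrite addr_ge0 ?mulr_ge0 ?subr_ge0.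
Qed.

Lemma pbin_var_le_mean s : prob_seq s -> pbin_var s <= pbin_mean s.
Proof.
elim: s => [|w s IHs] /=; first by rewrite /pbin_var /pbin_mean !big_nil.
case/andP=> /andP[w0 w1] /IHs le_s.
rewrite pbin_var_cons /pbin_mean big_cons -/(pbin_mean s) lerD//.
by rewrite ler_piMr// lerBlDr lerDl.
Qed.

Lemma pbin_poly1 s : (pbin_poly s).[1] = 1.
Proof.
rewrite /pbin_poly horner_prod big1// => w _.
by rewrite !hornerE subrK.
Qed.

Lemma stein_poly1 s : (stein_poly s).[1] = pbin_var s.
Proof.
elim: s => [|w s IHs]; first by rewrite /= horner0 /pbin_var big_nil.
by rewrite /= pbin_var_cons !hornerE pbin_poly1 IHs; ring.
Qed.

Lemma deriv_bernoulli w : (bernoulli_poly w)^`() = w%:P.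
Proof. by rewrite /bernoulli_poly !poly.derivE/=; ring. Qed.

(** Each factor satisfies [X w - w (1 - w + w X) = w (1 - w) (X - 1)]; by the product rule it
    contributes [w (1 - w) (X - 1)] times the product of the others. *)
Lemma stein_identity s :
  'X * (pbin_poly s)^`() - (pbin_mean s)%:P * pbin_poly s
  = ('X - 1) * stein_poly s.
Proof.
elim: s => [|w s IHs].
  by rewrite /= /pbin_poly /pbin_mean !big_nil derivC; ring.
rewrite pbin_poly_cons derivM deriv_bernoulli /pbin_mean big_cons.
rewrite -/(pbin_mean s) polyCD.
have {IHs} : 'X * (pbin_poly s)^`() =
   ('X - 1) * stein_poly s + (pbin_mean s)%:P * pbin_poly s.
  by rewrite -IHs subrK.
move=> E; rewrite mulrDr (mulrCA 'X (bernoulli_poly w)) E /= /bernoulli_poly.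
ring.
Qed.

Definition nneg_poly p := forall m, 0 <= p`_m.

Lemma nneg_polyD p q : nneg_poly p -> nneg_poly q -> nneg_poly (p + q).
Proof. by move=> p0 q0 m; rewrite coefD addr_ge0. Qed.

Lemma nneg_polyM p q : nneg_poly p -> nneg_poly q -> nneg_poly (p * q).
Proof. by move=> p0 q0 m; rewrite coefM sumr_ge0// => i _; rewrite mulr_ge0. Qed.

Lemma nneg_polyC (c : R) : 0 <= c -> nneg_poly c%:P.
Proof. by move=> c0 m; rewrite coefC; case: ifP. Qed.

Lemma nneg_polyX : nneg_poly 'X.
Proof. by move=> m; rewrite coefX ler0n. Qed.

Lemma nneg_bernoulli w : 0 <= w <= 1 -> nneg_poly (bernoulli_poly w).
Proof.
case/andP=> w0 w1; rewrite /bernoulli_poly -polyC1 -polyCB.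
apply: nneg_polyD; first by apply: nneg_polyC; rewrite subr_ge0.
by apply: nneg_polyM; [exact: nneg_polyC | exact: nneg_polyX].
Qed.

Lemma nneg_pbin s : prob_seq s -> nneg_poly (pbin_poly s).
Proof.
elim: s => [|w s IHs] /=.
  by rewrite /pbin_poly big_nil => _; apply: nneg_polyC.
case/andP=> w01 /IHs s0; rewrite pbin_poly_cons.
by apply: nneg_polyM => //; exact: nneg_bernoulli.
Qed.

Lemma nneg_stein s : prob_seq s -> nneg_poly (stein_poly s).
Proof.
elim: s => [|w s IHs] /=; first by move=> _ m; rewrite coef0.
case/andP=> w01 sP; case/andP: (w01) => w0 w1; rewrite -polyC1 -polyCB -polyCM.
apply: nneg_polyD; apply: nneg_polyM; last exact: IHs.
- by apply: nneg_polyC; rewrite mulr_ge0 ?subr_ge0.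
- exact: nneg_pbin.
- exact: nneg_bernoulli.
Qed.

(** The difference is a sum over [w] of [w (1 - w) (1 + X - bernoulli_poly w)] times the law of the
    other variables, and [1 + X - bernoulli_poly w = w + (1 - w) X] has nonnegative coefficients. *)
Lemma nneg_stein_pbin s : prob_seq s ->
  nneg_poly ((1 + 'X) * stein_poly s - (pbin_var s)%:P * pbin_poly s).
Proof.
elim: s => [|w s IHs] /=.
  by move=> _ m; rewrite /pbin_var big_nil mulr0 mul0r subrr coef0.
case/andP=> w01 sP; rewrite pbin_var_cons pbin_poly_cons.
set p := (X in nneg_poly X).
have -> : p = bernoulli_poly w *
     ((1 + 'X) * stein_poly s - (pbin_var s)%:P * pbin_poly s) +
     (w * (1 - w))%:P * (w%:P + (1 - w)%:P * 'X) * pbin_poly s.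
  by rewrite /p /bernoulli_poly !(polyCD, polyCM, polyCN); ring.
case/andP: (w01) => w0 w1.
apply: nneg_polyD; apply: nneg_polyM; [exact: nneg_bernoulli|exact: IHs| |].
- apply: nneg_polyM; first by apply: nneg_polyC; rewrite mulr_ge0 ?subr_ge0.
  apply: nneg_polyD; first exact: nneg_polyC.
  by apply: nneg_polyM (nneg_polyX); apply: nneg_polyC; rewrite subr_ge0.
- exact: nneg_pbin.
Qed.

(* [stein s m] is the tail sum of [(k - mean) P(k)] over [k >= m]. *)
Definition stein s m : R := ('X * stein_poly s)`_m.

Lemma stein0 s : stein s 0 = 0.
Proof. by rewrite /stein coefXM. Qed.

Lemma steinS s m : stein s m.+1 = (stein_poly s)`_m.
Proof. by rewrite /stein coefXM. Qed.

Lemma stein_ge0 s m : prob_seq s -> 0 <= stein s m.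
Proof.
move=> sP; rewrite /stein coefXM; case: m => [|m]//=.
exact: nneg_stein.
Qed.

Lemma pbin_ge0 s m : prob_seq s -> 0 <= (pbin_poly s)`_m.
Proof. by move=> /nneg_pbin. Qed.

Lemma steinE s m :
  (m%:R - pbin_mean s) * (pbin_poly s)`_m = stein s m - stein s m.+1.
Proof.
have /(congr1 (fun p : {poly R} => p`_m)) := stein_identity s.
rewrite mulrBl mul1r !coefB coefCM -/(stein s m) steinS => <-.
rewrite coefXM coef_deriv mulrBl; congr (_ - _).
by case: m => [|m] /=; rewrite ?mul0r// mulr_natl.
Qed.

Lemma pbin_stein_le s m : prob_seq s ->
  pbin_var s * (pbin_poly s)`_m <= stein s m + stein s m.+1.
Proof.
move=> sP; have := nneg_stein_pbin sP m.
rewrite coefB coefCM mulrDl mul1r coefD subr_ge0 => /le_trans; apply.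
by rewrite steinS addrC.
Qed.

End PoissonBinomial.

(** * Bounds on the maximum, the increments and the Stein remainder of a Bernoulli sum *)

Section PoissonBinomialBounds.
Variable R : rcfType.
Implicit Types (w C : R) (s t : seq R) (p q : {poly R}) (m k n : nat).

Lemma size_bernoulli w : (size (bernoulli_poly w) <= 2)%N.
Proof.
rewrite /bernoulli_poly -polyC1 -polyCB addrC size_MXaddC.
by case: ifP => // _; rewrite ltnS size_polyC_leq1.
Qed.

Lemma size_mul_bernoulli w p n :
  (size p <= n)%N -> (size (bernoulli_poly w * p)%R <= n.+1)%N.
Proof.
move=> pn; apply: leq_trans (size_polyMleq _ _) _.
by rewrite -subn1 leq_subLR (leq_add (size_bernoulli w) pn).
Qed.

Lemma size_pbin s : (size (pbin_poly s) <= (size s).+1)%N.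
Proof.
elim: s => [|w s IHs]; first by rewrite /pbin_poly big_nil size_poly1.
by rewrite pbin_poly_cons size_mul_bernoulli.
Qed.

Lemma size_stein s : (size (stein_poly s) <= size s)%N.
Proof.
elim: s => [|w s IHs] /=; first by rewrite size_poly0.
apply: leq_trans (size_polyD _ _) _; rewrite geq_max size_mul_bernoulli// andbT.
rewrite -polyC1 -polyCB -polyCM mul_polyC.
exact: leq_trans (size_scale_leq _ _) (size_pbin s).
Qed.

Lemma sum_pbin s : \sum_(k < (size s).+1) (pbin_poly s)`_k = 1.
Proof.
rewrite -(pbin_poly1 s) (horner_coef_wide _ (size_pbin s)).
by apply: eq_bigr => k _; rewrite expr1n mulr1.
Qed.

Lemma stein_end s : stein s (size s).+1 = 0.
Proof. by rewrite steinS nth_default// size_stein. Qed.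

Lemma stein_tail s m : (m <= (size s).+1)%N ->
  stein s m = \sum_(m <= k < (size s).+1) (k%:R - pbin_mean s) * (pbin_poly s)`_k.
Proof.
move=> ms; under eq_bigr => k _ do rewrite steinE -opprB.
by rewrite sumrN telescope_sumr// stein_end sub0r opprK.
Qed.

Lemma pbin_mean_sum s :
  \sum_(k < (size s).+1) k%:R * (pbin_poly s)`_k = pbin_mean s.
Proof.
have := stein_tail (leq0n (size s).+1); rewrite stein0 big_mkord => /esym.
under eq_bigr => k _ do rewrite mulrBl.
by rewrite sumrB -mulr_sumr sum_pbin mulr1 => /subr0_eq.
Qed.

Lemma pbin_var_sum s :
  \sum_(k < (size s).+1) (k%:R - pbin_mean s) ^+ 2 * (pbin_poly s)`_k = pbin_var s.
Proof.
set c := pbin_mean s.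
(* [T] multiplies the coefficient of index [k] by [k - c], so the sum is [T (T P)] at [1]. By
   [stein_identity], [T P = ('X - 1) * stein_poly s], and at [1] only the derivative of ['X - 1]
   survives. *)
pose T p : {poly R} := 'X * p^`() - c%:P * p.
have TE p k : (T p)`_k = (k%:R - c) * p`_k.
  rewrite /T coefB coefCM coefXM coef_deriv mulrBl; congr (_ - _).
  by case: k => [|k] /=; rewrite ?mul0r// mulr_natl.
have sT p n : (size p <= n)%N -> (size (T p) <= n)%N.
  move=> pn; apply/leq_sizeP => j nj.
  by rewrite TE (nth_default _ (leq_trans pn nj)) mulr0.
have TT1 : (T (T (pbin_poly s))).[1] = pbin_var s.
  rewrite [X in T X]stein_identity /T derivM !poly.derivE !hornerE/=.
  by rewrite stein_poly1; ring.
rewrite -TT1 (horner_coef_wide _ (sT _ _ (sT _ _ (size_pbin s)))).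
by apply: eq_bigr => k _; rewrite expr1n mulr1 !TE mulrA.
Qed.

(* Pointwise [x <= (x^2 / sigma + sigma) / 2]. *)
Lemma stein_le s m : prob_seq s -> stein s m <= Num.sqrt (pbin_var s).
Proof.
move=> sP; set sg := Num.sqrt _; set V := pbin_var s.
have V0 : 0 <= V by exact: pbin_var_ge0.
have sg2 : sg * sg = V by rewrite -expr2 sqr_sqrtr.
have [ms|ms] := leqP m (size s).+1; last first.
  rewrite /stein coefXM; case: m ms => [|m]//= ms.
  by rewrite nth_default ?sqrtr_ge0// (leq_trans (size_stein s))// -ltnS ltnW.
have sg0 : 0 <= sg by exact: sqrtr_ge0.
pose f k := ((k%:R - pbin_mean s) ^+ 2 + V) / 2 * (pbin_poly s)`_k.
have f0 k : 0 <= f k.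
  by rewrite /f mulr_ge0 ?pbin_ge0// divr_ge0// addr_ge0// sqr_ge0.
have sumf : \sum_(0 <= k < (size s).+1) f k = V.
  rewrite big_mkord /f; under eq_bigr => k _ do rewrite mulrAC mulrDl.
  rewrite -mulr_suml big_split/= pbin_var_sum -mulr_sumr sum_pbin -/V; lra.
have le1 : sg * stein s m <= V.
  rewrite (stein_tail ms) -sumf [leRHS](big_cat_nat _ (n := m))//= mulr_sumr.
  rewrite -[leLHS]add0r lerD// ?sumr_ge0// ler_sum// => k _.
  rewrite mulrA ler_wpM2r ?pbin_ge0//.
  have := sqr_ge0 (k%:R - pbin_mean s - sg).
  rewrite sqrrB [sg ^+ 2]expr2 sg2 -mulr_natr; lra.
(* When the variance is [0] one cannot cancel [sg], but then every term [(k - mean) P(k)] of the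
   tail vanishes. *)
have := sg0; rewrite le_eqVlt => /predU1P[sg00|sgp].
  have V00 : V = 0 by rewrite -sg2 -sg00 mul0r.
  rewrite -sg00 (stein_tail ms) big_nat_cond big1 ?lexx// => k /andP[/andP[_ kn] _].
  have : \sum_(k < (size s).+1) (k%:R - pbin_mean s) ^+ 2 * (pbin_poly s)`_k = 0.
    by rewrite pbin_var_sum.
  move=> /eqP; rewrite psumr_eq0; last first.
    by move=> i _; rewrite mulr_ge0 ?sqr_ge0 ?pbin_ge0.
  move=> /allP/(_ (Ordinal kn)); rewrite mem_index_enum => /(_ isT)/=.
  by rewrite mulf_eq0 sqrf_eq0 => /orP[] /eqP ->; rewrite ?mul0r ?mulr0.
by rewrite -(ler_pM2l sgp) sg2.
Qed.

Lemma pbin_le s m : prob_seq s -> 0 < pbin_var s ->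
  (pbin_poly s)`_m <= 2 / Num.sqrt (pbin_var s).
Proof.
move=> sP V0; rewrite ler_pdivlMr ?sqrtr_gt0//.
rewrite -(ler_pM2l (_ : 0 < Num.sqrt (pbin_var s))) ?sqrtr_gt0//.
rewrite mulrCA -expr2 (sqr_sqrtr (ltW V0)) mulrC.
apply: le_trans (pbin_stein_le _ sP) _.
by have := stein_le m sP; have := stein_le m.+1 sP; lra.
Qed.

(** Imposed for all [i <= j] and not only for [i = j]: with zero coefficients allowed, the diagonal
    inequalities alone would not imply the others. *)
Definition log_concave p :=
  forall i j, (i <= j)%N -> p`_i * p`_j.+2 <= p`_i.+1 * p`_j.+1.

Lemma coef_bernoulliM0 w p : (bernoulli_poly w * p)`_0 = (1 - w) * p`_0.
Proof.
by rewrite /bernoulli_poly -polyC1 -polyCB mulrDl coefD coefCM -mulrA coefCM coefXM mulr0 addr0.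
Qed.

Lemma coef_bernoulliMS w p k :
  (bernoulli_poly w * p)`_k.+1 = (1 - w) * p`_k.+1 + w * p`_k.
Proof.
by rewrite /bernoulli_poly -polyC1 -polyCB mulrDl coefD coefCM -mulrA coefCM coefXM.
Qed.

Lemma log_concave_bernoulli w p : 0 <= w <= 1 -> nneg_poly p ->
  log_concave p -> log_concave (bernoulli_poly w * p).
Proof.
move=> /andP[w0 w1] p0 lc i j ij.
have v0 : 0 <= 1 - w by rewrite subr_ge0.
have vv : 0 <= (1 - w) * (1 - w) by rewrite mulr_ge0.
have vw : 0 <= (1 - w) * w by rewrite mulr_ge0.
have ww : 0 <= w * w by rewrite mulr_ge0.
case: i ij => [|i] ij.
  rewrite coef_bernoulliM0 !coef_bernoulliMS.
  have h1 := ler_wpM2l vv (lc 0%N j ij).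
  have h2 : 0 <= (1 - w) * w * (p`_1 * p`_j) by rewrite !mulr_ge0.
  have h3 : 0 <= w * w * (p`_0 * p`_j) by rewrite !mulr_ge0.
  nra.
case: j ij => // j ij; rewrite !coef_bernoulliMS.
have h1 := ler_wpM2l vv (lc i.+1 j.+1 ij).
have h3 := ler_wpM2l ww (lc i j ij).
(* The mixed terms share [p_(i+1) p_(j+2)]; what is left takes two uses of log-concavity, or one and
   commutativity when [i = j]. *)
have h2 : p`_i * p`_j.+3 <= p`_i.+2 * p`_j.+1.
  apply: le_trans (lc i j.+1 (leqW ij)) _.
  move: ij; rewrite ltnS leq_eqVlt => /predU1P[->|]; first by rewrite mulrC.
  exact: lc.
have {}h2 := ler_wpM2l vw h2.
nra.
Qed.

Lemma log_concave_pbin s : prob_seq s -> log_concave (pbin_poly s).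
Proof.
elim: s => [|w s IHs] /=.
  by move=> _ i j ij; rewrite /pbin_poly big_nil !coef1/= !mulr0.
case/andP=> w01 sP; rewrite pbin_poly_cons.
by apply: log_concave_bernoulli => //; [exact: nneg_pbin|exact: IHs].
Qed.

(** Unimodality: for [i < j], [p_i p_(j+1) <= p_(i+1) p_j <= p_i p_j], and [p_i > 0] cancels. *)
Lemma log_concave_decr p i j : nneg_poly p -> log_concave p ->
  p`_i.+1 < p`_i -> (i <= j)%N -> p`_j.+1 <= p`_j.
Proof.
move=> p0 lc pi; rewrite leq_eqVlt => /predU1P[<-|]; first exact: ltW.
case: j => // j; rewrite ltnS => ij.
rewrite -(ler_pM2l (le_lt_trans (p0 _) pi)); apply: le_trans (lc _ _ ij) _.
by rewrite ler_wpM2r// ltW.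
Qed.

Lemma coef_subX1M0 p : (('X - 1) * p)`_0 = - p`_0.
Proof. by rewrite mulrBl mul1r coefB coefXM sub0r. Qed.

Lemma coef_subX1MS p k : (('X - 1) * p)`_k.+1 = p`_k - p`_k.+1.
Proof. by rewrite mulrBl mul1r coefB coefXM. Qed.

Lemma total_variation_le p C n : nneg_poly p -> log_concave p ->
  (forall k, p`_k <= C) -> \sum_(k < n) `|(('X - 1) * p)`_k| <= 2 * C.
Proof.
move=> p0 lc pC.
(* Invariant along a unimodal sequence: while it rises, the variation telescopes to [p_m]; after a
   descent, it is at most [2 C - p_m]. *)
suff H m : let T := \sum_(k < m.+1) `|(('X - 1) * p)`_k| in
    T = p`_m \/ T <= 2 * C - p`_m /\ exists2 i, (i <= m)%N & p`_i.+1 < p`_i.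
  case: n => [|n]; first by rewrite big_ord0 mulr_ge0 ?(le_trans (p0 0%N) (pC 0%N)).
  have p0n := p0 n; have pCn := pC n.
  case: (H n) => /= [->|[le_n _]]; first lra.
  by apply: le_trans le_n _; lra.
elim: m => [|m IH]; first by left; rewrite big_ord1 coef_subX1M0 normrN ger0_norm.
rewrite /= big_ord_recr/= coef_subX1MS; case: IH => /= [->|[le_m [i im pi]]].
  have [mm|mm] := leP p`_m p`_m.+1; [left|right].
    by rewrite ler0_norm ?subr_le0//; ring.
  rewrite gtr0_norm ?subr_gt0//; split; last by exists m.
  by have := pC m; lra.
right; split; last by exists i => //; exact: leqW.
have mm := log_concave_decr p0 lc pi im.
by rewrite ger0_norm ?subr_ge0//; lra.
Qed.

Lemma coefM_le p q A B m : 0 <= B -> (\sum_(k < m.+1) `|p`_k| <= A) ->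
  (forall k, `|q`_k| <= B) -> `|(p * q)`_m| <= A * B.
Proof.
move=> B0 pA qB; rewrite coefM; apply: le_trans (ler_norm_sum _ _ _) _.
apply: le_trans (ler_wpM2r B0 pA); rewrite mulr_suml ler_sum// => k _.
by rewrite normrM ler_wpM2l.
Qed.

(** Elements are taken until the variance reaches [c]; the last one adds at most [1 / 4], the
    maximum of [w (1 - w)]. *)
Lemma pbin_split s (c : R) : prob_seq s -> 0 <= c <= pbin_var s ->
  exists s1 s2, s = s1 ++ s2 /\ c <= pbin_var s1 <= c + 4^-1.
Proof.
elim: s c => [|w s IHs] c.
  rewrite /pbin_var big_nil => _ /andP[c0 c1].
  by exists [::], [::]; split => //; rewrite big_nil; lra.
rewrite /= => /andP[/andP[w0 w1] sP]; rewrite pbin_var_cons => /andP[c0 c1].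
have [cw|cw] := leP c (w * (1 - w)).
  exists [:: w], s; split=> //; rewrite pbin_var_cons /pbin_var big_nil addr0 cw.
  by have := sqr_ge0 (w - 2^-1); rewrite expr2; nra.
have [||s1 [s2 [-> b]]] := IHs (c - w * (1 - w)) => //; first lra.
by exists (w :: s1), s2; split => //; rewrite pbin_var_cons; lra.
Qed.

Lemma prob_seq_cat s t : prob_seq (s ++ t) = prob_seq s && prob_seq t.
Proof. exact: all_cat. Qed.

(* Convolve the total variation of one half with the supremum of the other. *)
Lemma pbin_increment_le s m : prob_seq s -> 1 <= pbin_var s ->
  `|(('X - 1) * pbin_poly s)`_m| <= 32 / pbin_var s.
Proof.
move=> sP V1; set V := pbin_var s.
(* With this target both parts have variance at least [V / 2 - 1 / 8], which is at least [V / 4]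
   because [V >= 1]. *)
have [|s1 [s2 [sE /andP[b1 b2]]]] := @pbin_split s (V / 2 - 8^-1) sP.
  by rewrite -/V; rewrite -/V in V1; lra.
have VE : V = pbin_var s1 + pbin_var s2 by rewrite /V sE pbin_var_cat.
have V4 : V / 4 <= pbin_var s1 /\ V / 4 <= pbin_var s2.
  by rewrite -/V in V1; split; lra.
move: (sP); rewrite sE prob_seq_cat pbin_poly_cat mulrA => /andP[P1 P2].
have V0 : 0 < V by exact: lt_le_trans V1.
have sV : 0 < Num.sqrt V by rewrite sqrtr_gt0.
have bnd t k : prob_seq t -> V / 4 <= pbin_var t ->
    (pbin_poly t)`_k <= 4 / Num.sqrt V.
  move=> tP tV.
  have sq : Num.sqrt V / 2 <= Num.sqrt (pbin_var t).
    have -> : Num.sqrt V / 2 = Num.sqrt (V / 4).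
      rewrite sqrtrM ?ltW//; congr (_ * _).
      have -> : 4^-1 = (2^-1) ^+ 2 :> R by rewrite exprVn; congr (_^-1); ring.
      by rewrite sqrtr_sqr ger0_norm// invr_ge0.
    by rewrite ler_sqrt// (le_trans _ tV)// divr_ge0 ?ltW.
  have tV0 : 0 < pbin_var t by apply: lt_le_trans tV; rewrite divr_gt0.
  apply: le_trans (pbin_le k tP tV0) _.
  rewrite ler_pdivrMr ?sqrtr_gt0// mulrAC ler_pdivlMr//; lra.
have -> : 32 / V = 2 * (4 / Num.sqrt V) * (4 / Num.sqrt V).
  rewrite -[in LHS](sqr_sqrtr (ltW V0)); field; exact: lt0r_neq0.
apply: coefM_le; first by rewrite divr_ge0 ?ltW.
  apply: total_variation_le; [exact: nneg_pbin|exact: log_concave_pbin|].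
  by move=> k; apply: bnd V4.1.
by move=> k; rewrite ger0_norm ?pbin_ge0//; apply: bnd V4.2.
Qed.

(* [F] accumulates one term per element of [s], each carrying the law of the
   sum of the other elements. *)
Lemma leave_one_out_le (F : seq R -> {poly R}) (c : R -> R) C t s m :
  F [::] = 0 ->
  (forall w s, F (w :: s) =
     bernoulli_poly w * F s + (c w)%:P * (('X - 1) * pbin_poly s)) ->
  (forall w, 0 <= w <= 1 -> `|c w| <= w * (1 - w)) ->
  prob_seq s ->
  (forall s1 w s2 k, s = s1 ++ w :: s2 ->
     `|(('X - 1) * pbin_poly (t ++ s1 ++ s2))`_k| <= C) ->
  `|(pbin_poly t * F s)`_m| <= pbin_var s * C.
Proof.
move=> F0 FS cw; elim: s t => [|w s IHs] t /=.
  by rewrite F0 mulr0 coef0 normr0 /pbin_var big_nil mul0r.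
move=> /andP[w01 sP] H; rewrite FS.
(* [w] joins the block [t] for the induction hypothesis; the other summand is the term that leaves
   [w] out. *)
have -> : pbin_poly t * (bernoulli_poly w * F s +
      (c w)%:P * (('X - 1) * pbin_poly s)) =
    pbin_poly (rcons t w) * F s + (c w)%:P * (('X - 1) * pbin_poly (t ++ s)).
  rewrite -cats1 !pbin_poly_cat pbin_poly_cons [pbin_poly [::]]/pbin_poly big_nil.
  ring.
rewrite coefD coefCM pbin_var_cons addrC [leRHS]mulrDl.
apply: le_trans (ler_normD _ _) (lerD _ _).
  rewrite normrM; apply: ler_pM => //; first exact: cw.
  exact: (H [::] w s).
apply: IHs => // s1 w' s2 k sE.
by rewrite cat_rcons; apply: (H (w :: s1) w' s2); rewrite sE.
Qed.

(** Removing [w] costs at most [1 / 4] of a variance that is at least [2], so more than half remains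
    and [32] becomes at most [64]. *)
Lemma pbin_remove_le s1 w s2 k : prob_seq (s1 ++ w :: s2) ->
  2 <= pbin_var (s1 ++ w :: s2) ->
  `|(('X - 1) * pbin_poly (s1 ++ s2))`_k| <= 64 / pbin_var (s1 ++ w :: s2).
Proof.
rewrite prob_seq_cat /= => /and3P[P1 /andP[w0 w1] P2] V2.
have VE : pbin_var (s1 ++ w :: s2) = w * (1 - w) + pbin_var (s1 ++ s2).
  by rewrite !pbin_var_cat pbin_var_cons; ring.
have w4 : w * (1 - w) <= 4^-1.
  by have := sqr_ge0 (w - 2^-1); rewrite expr2; nra.
have V1 : pbin_var (s1 ++ w :: s2) <= 2 * pbin_var (s1 ++ s2) by lra.
have V0 : 1 <= pbin_var (s1 ++ s2) by lra.
apply: le_trans (pbin_increment_le _ _ _) _ => //; first by rewrite prob_seq_cat P1.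
rewrite ler_pdivrMr; last lra.
rewrite mulrAC ler_pdivlMr; lra.
Qed.

(** By [steinE] this is a coefficient of [('X - 1) * stein_poly s], a combination of leave-one-out
    increments with weights [w (1 - w)]. The weights add up to the variance and each increment is at
    most [64] over it. *)
Lemma pbin_tail_le s m : prob_seq s -> 2 <= pbin_var s ->
  `|(m%:R - pbin_mean s) * (pbin_poly s)`_m| <= 64.
Proof.
move=> sP V2.
have -> : (m%:R - pbin_mean s) * (pbin_poly s)`_m =
    (pbin_poly [::] * (('X - 1) * stein_poly s))`_m.
  by rewrite [pbin_poly [::]]/pbin_poly big_nil mul1r steinE mulrBl mul1r coefB
    steinS.
have -> : 64 = pbin_var s * (64 / pbin_var s) by field; apply/eqP; lra.
apply: (@leave_one_out_le (fun s => ('X - 1) * stein_poly s)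
  (fun w => w * (1 - w))) => //.
- by rewrite /= mulr0.
- by move=> w t /=; rewrite polyCM polyCB; ring.
- by move=> w /andP[w0 w1]; rewrite ger0_norm// mulr_ge0// subr_ge0.
- by move=> s1 w s2 k sE /=; rewrite sE; apply: pbin_remove_le; rewrite -sE.
Qed.

(** As [bernoulli_poly w - 1 = w ('X - 1)], comparing with [stein s m.+1] leaves leave-one-out
    increments of weight [w^2 (1 - w)], hence an error [64]. Passing to [stein s m] costs [64] more
    by [pbin_tail_le]. *)
Lemma stein_approx s m : prob_seq s -> 2 <= pbin_var s ->
  `|pbin_var s * (pbin_poly s)`_m - stein s m| <= 128.
Proof.
move=> sP V2.
have : `|pbin_var s * (pbin_poly s)`_m - stein s m.+1| <= 64.
  have -> : pbin_var s * (pbin_poly s)`_m - stein s m.+1 =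
      (pbin_poly [::] * ((pbin_var s)%:P * pbin_poly s - stein_poly s))`_m.
    by rewrite [pbin_poly [::]]/pbin_poly big_nil mul1r steinS coefB coefCM.
  have -> : 64 = pbin_var s * (64 / pbin_var s) by field; apply/eqP; lra.
  apply: (@leave_one_out_le (fun s => (pbin_var s)%:P * pbin_poly s - stein_poly s)
    (fun w => w * (w * (1 - w)))) => //.
  - by rewrite /= /pbin_var /pbin_poly !big_nil mul0r subr0.
  - move=> w t /=; rewrite pbin_var_cons pbin_poly_cons /bernoulli_poly.
    by rewrite !(polyCD, polyCM, polyCN); ring.
  - move=> w /andP[w0 w1].
    by rewrite ger0_norm ?ler_piMl// !mulr_ge0// subr_ge0.
  - by move=> s1 w s2 k sE /=; rewrite sE; apply: pbin_remove_le; rewrite -sE.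
have := pbin_tail_le m sP V2; rewrite steinE !ler_norml; lra.
Qed.

End PoissonBinomialBounds.

(** * Spectrum of the graph Laplacian *)

Section LaplacianSpectrum.
Variable G : sgraph.

Lemma deg_card (j : 'I_(nv G)) : deg j = (\sum_i adj G j i)%N.
Proof.
rewrite /deg -sum1_card big_mkcond/=; apply: eq_bigr => i _.
have -> : (i \in [set k | adj G j k]) = adj G j i by apply/idP/idP; rewrite inE.
by case: (adj G j i).
Qed.

Lemma degE (R : nzRingType) (j : 'I_(nv G)) :
  (deg j)%:R = \sum_i (adj G i j)%:R :> R.
Proof.
by rewrite deg_card natr_sum; apply: eq_bigr => i _; rewrite adj_sym.
Qed.

Lemma laplacianE (R : nzRingType) (i j : 'I_(nv G)) :
  laplacian R G i j = (i == j)%:R * (deg j)%:R - (adj G i j)%:R.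
Proof.
rewrite !mxE; case: eqVneq => [->|_]; rewrite ?mul1r ?mul0r; congr (_ - _);
  by case: (adj _ _ _).
Qed.

Section Eigenvalue.
Variables (C : numClosedFieldType) (l : C) (v : 'rV[C]_(nv G)).
Hypotheses (vL : v *m laplacian C G = l *: v) (v0 : v != 0).

Let z i : C := v 0 i.
Let A i j : C := (adj G i j)%:R.

(** [e = -1] gives the Laplacian form and [e = 1] the signless one; the sums run over ordered pairs,
    so each edge counts twice. *)
Let quadratic_form (e : C) : e = 1 \/ e = -1 ->
  \sum_j \sum_i A i j * `|z i + e * z j| ^+ 2 =
  2 * \sum_j (deg j)%:R * `|z j| ^+ 2 + 2 * e * \sum_j \sum_i A i j * (z i * (z j)^*).
Proof.
move=> eP.
have ec : e^* = e by case: eP => ->; rewrite ?rmorphN1 ?rmorph1.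
have ee : e * e = 1 by case: eP => ->; rewrite ?mulrNN mulr1.
have AC i j : A i j = A j i by rewrite /A adj_sym.
have d1 : \sum_j (deg j)%:R * `|z j| ^+ 2 = \sum_j \sum_i A i j * (z j * (z j)^*).
  by apply: eq_bigr => j _; rewrite degE mulr_suml normCK.
have d2 : \sum_j (deg j)%:R * `|z j| ^+ 2 = \sum_j \sum_i A i j * (z i * (z i)^*).
  rewrite d1 exchange_big; apply: eq_bigr => j _; apply: eq_bigr => i _.
  by rewrite AC.
have s2 : \sum_j \sum_i A i j * (z i * (z j)^*) = \sum_j \sum_i A i j * (z j * (z i)^*).
  rewrite exchange_big; apply: eq_bigr => j _; apply: eq_bigr => i _.
  by rewrite AC.
rewrite mulr2n mulrDl mul1r {1}d1 d2 mulrDl mul1r [(e + e) * _]mulrDl {2}s2.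
rewrite !mulr_sumr -!big_split/=; apply: eq_bigr => j _.
rewrite !mulr_sumr -!big_split/=; apply: eq_bigr => i _.
rewrite normCK rmorphD rmorphM/= ec -[X in _ = A i j * X + _ + _]mul1r -ee; ring.
Qed.

Let eigen_form :
  \sum_j \sum_i A i j * (z i * (z j)^*) =
  \sum_j (deg j)%:R * `|z j| ^+ 2 - l * \sum_j `|z j| ^+ 2.
Proof.
apply/eqP; rewrite eq_sym subr_eq addrC -subr_eq eq_sym; apply/eqP.
rewrite mulr_sumr -sumrB; apply: eq_bigr => j _.
have := congr1 (fun M : 'rV_(nv G) => M 0 j) vL; rewrite !mxE => E.
rewrite normCK; symmetry; rewrite [RHS]mulrA -[l * z j]E mulr_suml.
under [RHS]eq_bigr => i _ do rewrite laplacianE mulrBr mulrBl.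
rewrite sumrB; congr (_ - _); last by apply: eq_bigr => i _; rewrite /z /A; ring.
rewrite (bigD1 j)//= big1 ?addr0; first by rewrite eqxx mul1r /z; ring.
by move=> i /negPf ij; rewrite ij mul0r mulr0 mul0r.
Qed.

Let norm_gt0 : 0 < \sum_j `|z j| ^+ 2.
Proof.
rewrite lt0r sumr_ge0 ?andbT; last by move=> j _; rewrite exprn_ge0.
apply: contra v0 => /eqP; move/eqP; rewrite psumr_eq0; last first.
  by move=> j _; rewrite exprn_ge0.
move=> /allP v00; apply/eqP/rowP => j; rewrite mxE; apply/eqP.
by have := v00 j (mem_index_enum _); rewrite /= sqrf_eq0 normr_eq0.
Qed.

(** Both quadratic forms are nonnegative: [e = -1] gives [0 <= 2 N l], and [e = 1] gives
    [2 N l <= 4 D <= 4 Delta N]. In the order of [C], [0 <= l] also says that [l] is real. *)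
Lemma laplacian_eigenvector_bound : 0 <= l <= 2 * (maxdeg G)%:R.
Proof.
set N := \sum_j `|z j| ^+ 2; have N0 : 0 < N by exact: norm_gt0.
pose D := \sum_j (deg j)%:R * `|z j| ^+ 2.
have q0 e : 0 <= \sum_j \sum_i A i j * `|z i + e * z j| ^+ 2.
  by rewrite !sumr_ge0// => j _; rewrite sumr_ge0// => i _; rewrite mulr_ge0 ?exprn_ge0.
have dN : D <= (maxdeg G)%:R * N.
  rewrite mulr_sumr ler_sum// => j _; rewrite ler_wpM2r ?exprn_ge0// ler_nat.
  exact: leq_bigmax.
apply/andP; split.
- have := q0 (-1); rewrite quadratic_form; last by right.
  have -> : 2 * D + 2 * -1 * \sum_j \sum_i A i j * (z i * (z j)^*) = 2 * N * l.
    by rewrite eigen_form -/D -/N; ring.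
  by rewrite pmulr_rge0// mulr_gt0.
- have := q0 1; rewrite quadratic_form; last by left.
  have -> : 2 * D + 2 * 1 * \sum_j \sum_i A i j * (z i * (z j)^*) = 4 * D - 2 * N * l.
    by rewrite eigen_form -/D -/N; ring.
  rewrite subr_ge0 => h; rewrite -(ler_pM2l (_ : 0 < 2 * N)) ?mulr_gt0//.
  apply: le_trans h _.
  have -> : 2 * N * (2 * (maxdeg G)%:R) = 4 * ((maxdeg G)%:R * N) by ring.
  by rewrite ler_wpM2l.
Qed.

End Eigenvalue.

Variable R : rcfType.

(** The characteristic polynomial splits over [R[i]]; its roots are real by the previous bound, so
    the factorization descends to [R]. *)
Lemma laplacian_spectrum : exists ls : seq R,
  char_poly (laplacian R G) = \prod_(l <- ls) ('X - l%:P) /\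
  all (fun l => 0 <= l <= 2 * (maxdeg G)%:R) ls.
Proof.
pose toC := @real_complex_def R (Phant R).
have [rs] := closed_field_poly_normal (char_poly (laplacian R[i] G)).
rewrite (monicP (char_poly_monic _)) scale1r => charE.
have bnd l : l \in rs -> 0 <= l <= 2 * (maxdeg G)%:R.
  move=> lrs; have : root (char_poly (laplacian R[i] G)) l.
    by rewrite charE root_prod_XsubC.
  rewrite -eigenvalue_root_char => /eigenvalueP[v vL v0].
  exact: laplacian_eigenvector_bound vL v0.
have ReK l : l \in rs -> toC (complex.Re l) = l.
  by move=> /bnd/andP[l0 _]; rewrite /toC RRe_real// ger0_real.
exists [seq complex.Re l | l <- rs]; split; last first.
  apply/allP => _ /mapP[l lrs ->]; have := bnd l lrs; rewrite -{1 2}(ReK l lrs).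
  have -> : 2 * (maxdeg G)%:R = toC (2 * (maxdeg G)%:R) by rewrite /toC rmorphM !rmorph_nat.
  by rewrite -[0]/(toC 0) !lecR.
apply: (map_poly_inj (real_complex R)).
rewrite map_char_poly rmorph_prod.
have -> : map_mx (real_complex R) (laplacian R G) = laplacian R[i] G.
  apply/matrixP => i j; rewrite [in LHS]mxE !laplacianE.
  by rewrite rmorphB rmorphM !rmorph_nat.
rewrite charE big_map big_seq [RHS]big_seq; apply: eq_bigr => l lrs.
by rewrite rmorphB/= map_polyX map_polyC/= -/toC ReK.
Qed.

(** Both sides are the trace, read off the coefficient of degree [nv G - 1]; the graph without
    vertices is treated apart. *)
Lemma sum_spectrum (ls : seq R) :
  char_poly (laplacian R G) = \prod_(l <- ls) ('X - l%:P) ->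
  \sum_(l <- ls) l = \sum_(i : 'I_(nv G)) (deg i)%:R.
Proof.
move=> charE; have sls : size ls = nv G.
  by apply: succn_inj; rewrite -(size_char_poly (laplacian R G)) charE size_prod_XsubC.
have [n0|n0] := eqVneq (size ls) 0%N.
  rewrite (size0nil n0) big_nil; move: n0; rewrite sls => n0.
  by rewrite big1// => -[i lt_i] _; exfalso; move: lt_i; rewrite n0.
apply: oppr_inj; rewrite -coefPn_prod_XsubC// -charE sls char_poly_trace; last first.
  by rewrite -sls lt0n.
congr (- _); apply: eq_bigr => i _.
by rewrite laplacianE eqxx adj_irr subr0 mul1r.
Qed.

Lemma nedges_le_sum_deg : (nedges G <= \sum_(i : 'I_(nv G)) deg i)%N.
Proof.
rewrite /nedges -sum1_card (eq_bigr _ (fun i _ => deg_card i)).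
rewrite pair_big/= big_mkcond/= leq_sum// => -[i j] _ /=.
case: ifP => //; rewrite inE /= => /andP[_ ->] //.
Qed.

End LaplacianSpectrum.

(** The sign cancels the one in Vieta's formulas: Laplacian coefficients are elementary symmetric
    functions of the eigenvalues. *)
Lemma coef_prod_XaddC (R : comNzRingType) (ls : seq R) (k : nat) :
  (-1) ^+ (size ls - k) * (\prod_(l <- ls) ('X - l%:P))`_k =
  (\prod_(l <- ls) ('X + l%:P))`_k.
Proof.
(* Above the degree the subtraction in the exponent truncates, but both coefficients are [0]. *)
have [kl|lk] := leqP k (size ls); last first.
  have sz0 (f : R -> R) : (\prod_(l <- ls) ('X - (f l)%:P))`_k = 0.
    by rewrite nth_default// -(big_map f xpredT (fun l => 'X - l%:P))
      size_prod_XsubC size_map.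
  rewrite (sz0 id) mulr0 -[LHS](sz0 -%R); congr ((polyseq _)`_k).
  by apply: eq_bigr => l _; rewrite polyCN opprK.
have -> : \prod_(l <- ls) ('X + l%:P) = \prod_(l <- [seq - l | l <- ls]) ('X - l%:P).
  by rewrite big_map; apply: eq_bigr => l _; rewrite polyCN opprK.
rewrite coef_prod_XsubC// mulrA -exprD addnn -mul2n exprM sqrrN expr1n expr1n mul1r.
rewrite coef_prod_XsubC size_map// big_distrr/=.
apply: eq_bigr => I /eqP cI; rewrite -cI -prodrN.
by apply: eq_bigr => i _; rewrite (nth_map 0) ?opprK.
Qed.

(** * Gaussian density and distribution function *)

Section Gaussian.
Variable R : realType.
Implicit Types x y t h : R.

(** Spelled as in [llt_normal], so that the two agree by conversion. *)
Definition gauss x : R := (Num.sqrt (pi *+ 2))^-1 * expR (- (x ^+ 2) / 2).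

Lemma gauss_pdf x : normal_pdf 0 1 x = gauss x.
Proof.
by rewrite normal_pdfE ?oner_neq0// /normal_peak /normal_fun /gauss expr1n mul1r subr0.
Qed.

Lemma inv_sqrt2pi_gt0 : 0 < (Num.sqrt (pi *+ 2))^-1 :> R.
Proof. by rewrite invr_gt0 sqrtr_gt0 mulrn_wgt0// pi_gt0. Qed.

Lemma inv_sqrt2pi_le1 : (Num.sqrt (pi *+ 2))^-1 <= 1 :> R.
Proof.
have s0 : 0 < Num.sqrt (pi *+ 2) :> R by rewrite -invr_gt0 inv_sqrt2pi_gt0.
rewrite (invf_le1 s0) -[leLHS]sqrtr1; apply: ler_wsqrtr.
by have := pi_ge2 R; rewrite mulr2n; lra.
Qed.

Lemma gauss_gt0 x : 0 < gauss x.
Proof. by rewrite mulr_gt0 ?expR_gt0 ?inv_sqrt2pi_gt0. Qed.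

Lemma gauss_le1 x : gauss x <= 1.
Proof.
rewrite /gauss mulr_ile1 ?expR_ge0 ?inv_sqrt2pi_le1 ?(ltW inv_sqrt2pi_gt0)//.
by rewrite -expR0 ler_expR mulNr oppr_le0 divr_ge0 ?sqr_ge0.
Qed.

Lemma gauss_itv01 x : 0 <= gauss x <= 1.
Proof. by rewrite gauss_le1 ltW ?gauss_gt0. Qed.

Lemma gauss_le x : 0 < x -> gauss x <= x^-1.
Proof.
move=> x0; rewrite /gauss -[leRHS]mul1r ler_pM ?expR_ge0 ?inv_sqrt2pi_le1 ?(ltW inv_sqrt2pi_gt0)//.
rewrite mulNr expRN lef_pV2 ?posrE ?expR_gt0//.
apply: le_trans (expR_ge1Dx _).
by have := sqr_ge0 (x - 1); rewrite sqrrB expr1n mulr1 -mulr_natr; lra.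
Qed.

Lemma is_derive_gauss x : is_derive x 1 gauss (- x * gauss x).
Proof.
rewrite /gauss; apply: is_derive_eq.
rewrite !scaler0 ?add0r ?addr0 /GRing.scale/=; set c := (Num.sqrt _)^-1.
by field.
Qed.

(** Mean value theorem: the derivative [- c * gauss c] has absolute value at most [1] by
    [gauss_le]. *)
Lemma gauss_lipschitz x y : `|gauss x - gauss y| <= `|x - y|.
Proof.
wlog xy : x y / y <= x => [H|].
  have [/H//|/ltW/H] := leP y x; by rewrite distrC [leRHS]distrC.
have [||c _ ->] := @MVT_segment R gauss (fun t => - t * gauss t) y x xy.
- by move=> t _; exact: is_derive_gauss.
- by apply: derivable_within_continuous => t _; have [] := is_derive_gauss t.
rewrite normrM ler_piMl// normrM normrN [`|gauss c|]ger0_norm ?(ltW (gauss_gt0 _))//.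
have [->|c0] := eqVneq c 0; first by rewrite normr0 mul0r.
have gE : gauss c = gauss `|c| by rewrite /gauss real_normK// num_real.
rewrite gE -ler_pdivlMl ?normr_gt0// mulr1 gauss_le ?normr_gt0//.
Qed.

Let P : probability (measurableTypeR R) R := normal_prob (0 : R) 1.

(** The identity as a random variable of law [P]; its [cdf] is [Phi], which gives the range of [Phi]
    and its limits at infinity. *)
Let idTR : measurableTypeR R -> R := idfun.

#[local] HB.instance Definition _ :=
  @isMeasurableFun.Build _ _ _ _ idTR (@measurable_id _ _ setT).

Lemma Phi_normal_prob x : (Phi x)%:E = normal_prob (0 : R) 1 `]-oo, x].
Proof.
rewrite -[RHS]fineK; last exact: (fin_num_measure P).
congr (_%:E); rewrite /Phi -RintegralZl//=.
  by rewrite /Rintegral /normal_prob; congr fine; apply: eq_integral => t _; rewrite gauss_pdf.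
have -> : EFin \o (fun t : R => expR (- t ^+ 2 / 2)) =
    (fun t => (Num.sqrt (pi *+ 2))%:E * (normal_pdf 0 1 t)%:E)%E.
  apply/funext => t; rewrite gauss_pdf /gauss -EFinM mulrA divff ?mul1r//.
  by rewrite gt_eqF// -invr_gt0 inv_sqrt2pi_gt0.
apply: integrableZl => //; apply: integrableS (integrable_normal_pdf 0 1) => //.
Qed.

Lemma Phi_cdf x : (Phi x)%:E = cdf (idTR : {RV P >-> R}) x.
Proof. exact: Phi_normal_prob. Qed.

Lemma Phi_ge0 x : 0 <= Phi x.
Proof. by rewrite -lee_fin Phi_cdf cdf_ge0. Qed.

Lemma Phi_le1 x : Phi x <= 1.
Proof. by rewrite -lee_fin Phi_cdf cdf_le1. Qed.

Lemma Phi_sub x y : x <= y ->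
  (Phi y - Phi x)%:E = (\int[lebesgue_measure]_(t in `]x, y]) (gauss t)%:E)%E.
Proof.
move=> xy.
have -> : (\int[lebesgue_measure]_(t in `]x, y]) (gauss t)%:E)%E = P `]x, y]%classic.
  by rewrite /P /= /normal_prob; apply: eq_integral => t _; rewrite gauss_pdf.
have : P `]-oo, y]%classic = (P `]-oo, x]%classic + P `]x, y]%classic)%E.
  rewrite -measureU//; first by rewrite -itv_bndbnd_setU// bnd_simp.
  apply/seteqP; split => // t [/=]; rewrite !in_itv/= => tx /andP[xt _].
  by move: (lt_le_trans xt tx); rewrite ltxx.
have PE t : P `]-oo, t]%classic = (Phi t)%:E by rewrite Phi_normal_prob.
rewrite !PE EFinB => ->.
by rewrite addeC addeA -EFinN -EFinD addNr add0e.
Qed.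

Lemma Phi_sub_bounds x y (a b : R) : x <= y -> 0 <= a ->
  (forall t, x <= t <= y -> a <= gauss t <= b) ->
  a * (y - x) <= Phi y - Phi x <= b * (y - x).
Proof.
move=> xy a0 H; have b0 : 0 <= b.
  by have /andP[] := H x (introT andP (conj (lexx x) xy)); lra.
have mg : measurable_fun (`]x, y]%classic : set R) (EFin \o gauss).
  apply/measurable_EFinP; rewrite (_ : gauss = normal_pdf 0 1).
    by apply: measurable_funTS; exact: measurable_normal_pdf.
  by apply/funext => t; rewrite gauss_pdf.
have cE (c : R) : (c * (y - x))%:E =
    (\int[lebesgue_measure]_(t in `]x, y]) (cst c%:E) t)%E.
  rewrite integral_cst//= lebesgue_measure_itv/= lte_fin.
  have := xy; rewrite le_eqVlt => /predU1P[->|->]; last by rewrite -EFinB EFinM.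
  by rewrite ltxx subrr mulr0 mule0.
have itvP t : `]x, y]%classic t -> x <= t <= y.
  by rewrite /= in_itv/= => /andP[/ltW -> ->].
rewrite -!lee_fin Phi_sub// !cE; apply/andP; split; apply: ge0_le_integral => //.
- by move=> t /itvP/H/andP[+ _]; rewrite lee_fin.
- by move=> t _; rewrite lee_fin ltW ?gauss_gt0.
- by move=> t /itvP/H/andP[_]; rewrite lee_fin.
Qed.

Lemma Phi_homo : {homo @Phi R : x y / x <= y}.
Proof.
move=> x y xy.
have /andP[+ _] := Phi_sub_bounds xy (lexx 0) (fun t _ => gauss_itv01 t).
by rewrite mul0r subr_ge0.
Qed.

Lemma Phi_lipschitz x y : `|Phi x - Phi y| <= `|x - y|.
Proof.
wlog xy : x y / y <= x => [H|].
  have [/H//|/ltW/H] := leP y x; by rewrite distrC [leRHS]distrC.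
have /andP[_ h2] := Phi_sub_bounds xy (lexx 0) (fun t _ => gauss_itv01 t).
by rewrite !ger0_norm ?subr_ge0// ?Phi_homo// -[leRHS]mul1r.
Qed.

(** On [[x, x + h]] the density stays within [h] of [gauss x], by the Lipschitz bound. *)
Lemma Phi_step x h : 0 <= h -> `|Phi (x + h) - Phi x - h * gauss x| <= h ^+ 2.
Proof.
move=> h0; have xh : x <= x + h by rewrite lerDl.
have gl t : x <= t <= x + h -> gauss x - h <= gauss t <= gauss x + h.
  move=> /andP[xt th]; have := gauss_lipschitz t x.
  rewrite [`|t - x|]ger0_norm ?subr_ge0// => H.
  by have {H} := le_trans H (_ : t - x <= h); rewrite lerBlDl => /(_ th);
    rewrite ler_distl.
have xhE : x + h - x = h by rewrite addrAC subrr add0r.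
(* [Phi_sub_bounds] requires a nonnegative lower bound: [0] replaces [gauss x - h] when the latter
   may be negative, and then [h * gauss x <= h ^ 2]. *)
have [hg|/ltW hg] := leP (gauss x) h.
  have gl0 t : x <= t <= x + h -> 0 <= gauss t <= gauss x + h.
    by move=> /gl/andP[_ ->]; rewrite ltW ?gauss_gt0.
  have /andP[h1 h2] := Phi_sub_bounds xh (lexx 0) gl0.
  rewrite xhE in h1 h2; rewrite ler_norml.
  by have := ltW (gauss_gt0 x); rewrite expr2; nra.
have g0 : 0 <= gauss x - h by rewrite subr_ge0.
have /andP[h1 h2] := Phi_sub_bounds xh g0 gl.
by rewrite xhE in h1 h2; rewrite ler_norml expr2; lra.
Qed.

Lemma Phi_tails (e : R) : 0 < e ->
  exists K, 0 < K /\ forall x, (K <= x -> 1 - e <= Phi x) /\ (x <= - K -> Phi x <= e).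
Proof.
move=> e0.
have Py : Phi x @[x --> +oo] --> (1 : R).
  have := @cvg_cdfy1 _ _ _ P (idTR : {RV P >-> R}).
  rewrite (_ : cdf _ = fun x => (Phi x)%:E); last by apply/funext => x; rewrite Phi_cdf.
  by move/fine_cvgP => [_]; apply: cvg_trans.
have PN : Phi x @[x --> -oo] --> (0 : R).
  have := @cvg_cdfNy0 _ _ _ P (idTR : {RV P >-> R}).
  rewrite (_ : cdf _ = fun x => (Phi x)%:E); last by apply/funext => x; rewrite Phi_cdf.
  by move/fine_cvgP => [_]; apply: cvg_trans.
move/cvgrPdist_le : Py => /(_ e e0) [K1 [_ H1]].
move/cvgrPdist_le : PN => /(_ e e0) [K2 [_ H2]].
exists (`|K1| + `|K2| + 1); split => [|x].
  by rewrite ltr_wpDl// addr_ge0.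
split => Kx.
  have K1x : K1 < x.
    by apply: lt_le_trans Kx; have := ler_norm K1; have := normr_ge0 K2; lra.
  by have := H1 x K1x; rewrite ler_norml; lra.
have K2x : x < K2.
  apply: le_lt_trans Kx _; have := ler_norm (- K2).
  by have := normr_ge0 K1; rewrite normrN; lra.
by have := H2 x K2x; rewrite sub0r normrN ler_norml; lra.
Qed.

End Gaussian.

(** * Abstract form of the law, and one step of the Euler scheme *)

(** All that the limit argument retains of a Bernoulli sum; [C] is to stay fixed while [sg] grows.
    [stein_seq_mean] places index [0] to the left of the window. *)
Record stein_sequence (R : realType) (C : R) (N : nat) (a S : nat -> R)
    (mu sg : R) : Prop := SteinSequence {
  stein_seq_ge0 : forall k, 0 <= a k;
  stein_seq_end : forall k, (N <= k)%N -> a k = 0;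
  stein_seq_sum : \sum_(k < N) a k = 1;
  stein_seq_var : \sum_(k < N) (k%:R - mu) ^+ 2 * a k = sg ^+ 2;
  stein_seq_diff : forall k, (k%:R - mu) * a k = S k - S k.+1;
  stein_seq_bound : forall k, 0 <= S k <= sg;
  stein_seq_approx : forall k, `|sg ^+ 2 * a k - S k| <= C;
  stein_seq_tail : forall k, `|(k%:R - mu) * a k| <= C;
  stein_seq_mean : sg ^+ 2 <= mu }.

Lemma expR_1BM_bounds (R : realType) (y : R) :
  `|y| <= 1 -> 1 - y ^+ 2 <= (1 - y) * expR y <= 1.
Proof.
rewrite ler_norml => /andP[y0 y1]; apply/andP; split.
  have -> : 1 - y ^+ 2 = (1 - y) * (1 + y) by ring.
  by rewrite ler_wpM2l ?subr_ge0// expR_ge1Dx.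
rewrite -ler_pdivlMr ?expR_gt0// mul1r -expRN.
exact: expR_ge1Dx.
Qed.

Lemma expR_half_sqr_le (R : realType) (h : R) : `|h| <= 1 -> expR (h ^+ 2 / 2) <= 1 + h ^+ 2.
Proof.
move=> h1; have h2 : h ^+ 2 <= 1 by rewrite -[h ^+ 2]ger0_norm ?sqr_ge0// normrX exprn_ile1.
have := sqr_ge0 h; set t := h ^+ 2 in h2 * => t0.
have := expR_ge1Dx (- (t / 2)); rewrite expRN => H.
have e0 : 0 < expR (t / 2) by exact: expR_gt0.
have : (1 - t / 2) * expR (t / 2) <= 1.
  by rewrite -ler_pdivlMr// mul1r.
by nra.
Qed.

(* [(1 - h x) exp (h x + h^2 / 2)] is the ratio of successive values of
   [u exp (x^2 / 2)] when [u] follows the Euler scheme of step [h]. *)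
Lemma ratio_step (R : realType) (K h x : R) : `|x| <= K -> 0 < h <= 1 -> K * h <= 1 ->
  `|(1 - h * x) * expR (h * x + h ^+ 2 / 2) - 1| <= (K ^+ 2 + 1) * h ^+ 2.
Proof.
move=> xK /andP[h0 h1] Kh.
have yK : `|h * x| <= h * K by rewrite normrM gtr0_norm// ler_pM2l.
have y1 : `|h * x| <= 1 by apply: le_trans yK _; rewrite mulrC.
have /andP[] := expR_1BM_bounds y1; rewrite expRD mulrA.
set p := (1 - _) * _ => p0 p1.
have e1 : expR (h ^+ 2 / 2) <= 1 + h ^+ 2.
  by apply: expR_half_sqr_le; rewrite gtr0_norm.
have e2 : 1 <= expR (h ^+ 2 / 2).
  by rewrite -[leLHS]expR0 ler_expR divr_ge0 ?sqr_ge0.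
have y2 : (h * x) ^+ 2 <= K ^+ 2 * h ^+ 2.
  rewrite -[leLHS]ger0_norm ?sqr_ge0// normrX -exprMn [K * h]mulrC.
  by rewrite lerXn2r// ?nnegrE// (le_trans _ yK).
have yy : (h * x) ^+ 2 <= 1.
  by rewrite -[leLHS]ger0_norm ?sqr_ge0// normrX exprn_ile1.
have pp : 0 <= p by lra.
have hh := sqr_ge0 h.
have hK : 0 <= K ^+ 2 * h ^+ 2 by rewrite mulr_ge0 ?sqr_ge0.
rewrite ler_norml mulrDl mul1r; nra.
Qed.

(** * Gaussian approximation on a bounded window, up to a constant factor *)

Section Window.
Variables (R : realType) (C : R) (N : nat) (a S : nat -> R) (mu sg : R).
Hypothesis ss : stein_sequence C N a S mu sg.
Variable K : R.
Hypotheses (K1 : 1 <= K) (Ksg : K <= sg).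

Let h := sg^-1.
Let x (k : nat) : R := (k%:R - mu) * h.

Let sg0 : 0 < sg. Proof. by have := K1; have := Ksg; lra. Qed.
Let h0 : 0 < h. Proof. by rewrite invr_gt0 sg0. Qed.
Let sgh : sg * h = 1. Proof. by rewrite divff// gt_eqF// sg0. Qed.
Let Kh : K * h <= 1. Proof. by rewrite -sgh ler_pM2r// Ksg. Qed.
Let h1 : h <= 1.
Proof. by have := Kh; have := K1; have := h0; nra. Qed.
Let C0 : 0 <= C. Proof. exact: le_trans (normr_ge0 _) (stein_seq_tail ss 0). Qed.

Let xS k : x k.+1 = x k + h.
Proof. by rewrite /x -natr1; ring. Qed.

Let xD k j : x (k + j) = x k + j%:R * h.
Proof. by rewrite /x natrD; ring. Qed.

Let x_lt k m : (x k < x m) = (k < m)%N.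
Proof. by rewrite /x ltr_pM2r// ltrD2r ltr_nat. Qed.

(** [x 0 = - mu / sg <= - sg <= - K]: the window does not start before index [0]. *)
Let x0 : x 0 <= - K.
Proof.
rewrite /x sub0r mulNr lerN2; apply: le_trans Ksg _.
rewrite ler_pdivlMr ?sg0// -expr2; exact: stein_seq_mean ss.
Qed.

Let t k := S k * h * expR (x k ^+ 2 / 2).

(* Bounds [|t k.+1 - t k| / h ^ 2]: the error of [ratio_step] plus the
   error [C] of the approximation of [sg ^ 2 * a k] by [S k]. *)
Definition window_step_bound :=
  expR (K ^+ 2 / 2) * (K ^+ 2 + 1 + K * C * expR 2).

Let step_ge0 : 0 <= window_step_bound.
Proof.
have K0 : 0 <= K by have := K1; lra.
by rewrite mulr_ge0 ?expR_ge0// !addr_ge0 ?sqr_ge0// !mulr_ge0 ?expR_ge0// C0.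
Qed.

Let u_bound k : 0 <= S k * h <= 1.
Proof.
have /andP[s0 s1] := stein_seq_bound ss k.
by rewrite -sgh ler_pM2r// s1 andbT mulr_ge0// ltW.
Qed.

Let expR_x k : `|x k| <= K -> expR (x k ^+ 2 / 2) <= expR (K ^+ 2 / 2).
Proof.
move=> xK; rewrite ler_expR ler_pM2r ?invr_gt0// -real_normK ?num_real//.
by rewrite lerXn2r ?nnegrE// (le_trans (normr_ge0 _) xK).
Qed.

(** Replacing [a k] by [(S k + r) h^2] with [|r| <= C] splits the step into the ideal Euler ratio,
    bounded by [ratio_step], and a term linear in [r]. *)
Let t_step k : `|x k| <= K -> `|t k.+1 - t k| <= window_step_bound * h ^+ 2.
Proof.
move=> xK; pose r := sg ^+ 2 * a k - S k.
have rC : `|r| <= C := stein_seq_approx ss k.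
have aE : a k = (S k + r) * h ^+ 2.
  have -> : (S k + r) * h ^+ 2 = (sg * h) ^+ 2 * a k by rewrite /r; ring.
  by rewrite sgh expr1n mul1r.
have SE : S k.+1 = S k - (k%:R - mu) * a k by rewrite (stein_seq_diff ss) opprB addrC subrK.
have dE : k%:R - mu = x k * sg.
  have -> : x k * sg = (k%:R - mu) * (sg * h) by rewrite /x; ring.
  by rewrite sgh mulr1.
have tE : t k.+1 - t k = expR (x k ^+ 2 / 2) *
    (S k * h * ((1 - h * x k) * expR (h * x k + h ^+ 2 / 2) - 1)
     - x k * h ^+ 2 * r * expR (h * x k + h ^+ 2 / 2)).
  have eE : expR (x k.+1 ^+ 2 / 2) = expR (x k ^+ 2 / 2) * expR (h * x k + h ^+ 2 / 2).
    by rewrite -expRD xS; congr expR; field.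
  have uE : S k.+1 * h = S k * h * (1 - h * x k) - x k * h ^+ 2 * r.
    rewrite SE aE dE.
    have -> : (S k - x k * sg * ((S k + r) * h ^+ 2)) * h =
      S k * h - x k * (S k + r) * h ^+ 2 * (sg * h) by ring.
    by rewrite sgh; ring.
  by rewrite /t eE uE; ring.
rewrite tE normrM ger0_norm ?expR_ge0// /window_step_bound -[leRHS]mulrA.
apply: ler_pM; rewrite ?expR_ge0 ?normr_ge0 ?expR_x//.
apply: le_trans (ler_normB _ _) _; rewrite [leRHS]mulrDl lerD//.
  have /andP[u0 u1] := u_bound k.
  rewrite normrM ger0_norm// -[leRHS]mul1r; apply: ler_pM => //.
  by apply: ratio_step => //; rewrite h0 h1.
have K0 : 0 <= K := le_trans (normr_ge0 _) xK.
rewrite normrM (normrM (x k * h ^+ 2)) (normrM (x k)).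
rewrite [`|expR _|]ger0_norm ?expR_ge0// [`|h ^+ 2|]ger0_norm ?sqr_ge0//.
have -> : K * C * expR 2 * h ^+ 2 = K * h ^+ 2 * C * expR 2 by ring.
have hx : h * x k <= 1.
  by apply: le_trans Kh; rewrite mulrC ler_pM2r// (le_trans (ler_norm _) xK).
have e2 : expR (h * x k + h ^+ 2 / 2) <= expR 2.
  by rewrite ler_expR expr2; have := h0; have := h1; nra.
have p1 : `|x k| * h ^+ 2 <= K * h ^+ 2 by rewrite ler_wpM2r ?sqr_ge0.
have p0 : 0 <= `|x k| * h ^+ 2 by rewrite mulr_ge0 ?sqr_ge0.
have p2 : `|x k| * h ^+ 2 * `|r| <= K * h ^+ 2 * C by apply: ler_pM.
apply: le_trans (ler_wpM2r (expR_ge0 _) p2) _.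
by rewrite ler_wpM2l// (le_trans _ p2)// mulr_ge0.
Qed.

Lemma window_start : exists b, (forall k, (b <= k)%N = (- K <= x k)) /\ x b <= - K + h.
Proof.
have exb : exists k, - K <= x k.
  exists (Num.truncn mu).+1; rewrite /x.
  have : mu < (Num.truncn mu).+1%:R by exact: truncnS_gt.
  move=> /ltW; rewrite -subr_ge0 => d0; have := mulr_ge0 d0 (ltW h0).
  by have := K1; lra.
case: (ex_minnP exb) => b bK bmin; exists b; split.
  move=> k; apply/idP/idP; last exact: bmin.
  by move=> bk; apply: le_trans bK _; rewrite leNgt x_lt -leqNgt.
(* If [b] is [0], the bound comes from [x 0 <= - K]; otherwise from the minimality of [b]. *)
case: b bK bmin => [_ _|b bK bmin].
  by have := x0; have := h0; lra.
rewrite xS lerD2r; have [//|/ltW/bmin] := leP (x b) (- K).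
by rewrite ltnn.
Qed.

(** The first term is the drift of [t] over at most [2 K / h] steps, the second the error between
    [sg ^ 2 * a k] and [S k]; the third bounds the constant [B] of [local_estimate]. *)
Definition window_bound :=
  2 * K * window_step_bound + C + (Num.sqrt (pi *+ 2)) * expR (K ^+ 2 / 2).

Lemma window_bound_ge0 : 0 <= window_bound.
Proof.
have K0 : 0 <= K by have := K1; lra.
apply: addr_ge0; last by rewrite mulr_ge0 ?sqrtr_ge0 ?expR_ge0.
by apply: addr_ge0 C0; apply: mulr_ge0 step_ge0; rewrite mulr_ge0.
Qed.

Lemma local_estimate : exists B, 0 <= B <= window_bound /\
  forall k, `|x k| <= K -> `|a k - h * (B * gauss (x k))| <= window_bound * h ^+ 2.
Proof.
have K0 : 0 <= K by have := K1; lra.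
have s2p : Num.sqrt (pi *+ 2) != 0 :> R.
  by rewrite gt_eqF// -invr_gt0 inv_sqrt2pi_gt0.
have [b [bP xb]] := window_start.
have xbK : `|x b| <= K.
  by rewrite ler_norml -bP leqnn/=; have := K1; have := h1; lra.
have /andP[ub0 ub1] := u_bound b.
(* [t] is nearly constant on the window, so its value at the left end serves as the constant; the
   square root undoes the normalization of [gauss]. *)
exists (t b * Num.sqrt (pi *+ 2)); split.
  rewrite mulr_ge0 ?sqrtr_ge0//=; last by rewrite /t mulr_ge0 ?expR_ge0.
  rewrite mulrC /window_bound -[leLHS]add0r lerD//.
    by apply: addr_ge0 C0; apply: mulr_ge0 step_ge0; rewrite mulr_ge0.
  rewrite ler_wpM2l ?sqrtr_ge0// /t -[leRHS]mul1r ler_pM ?expR_ge0//.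
  exact: expR_x.
move=> k xK.
have bk : (b <= k)%N by rewrite bP; move: xK; rewrite ler_norml => /andP[].
have tj j : x (b + j)%N <= K -> `|t (b + j)%N - t b| <= j%:R * (window_step_bound * h ^+ 2).
  elim: j => [|j IHj] xj; first by rewrite addn0 subrr normr0 mul0r.
  move: xj; rewrite addnS xS => xj.
  have xjK : x (b + j)%N <= K by have := h0; lra.
  have xjK' : `|x (b + j)%N| <= K by rewrite ler_norml -bP leq_addr.
  have := t_step xjK'; have := IHj xjK; rewrite -natr1 mulrDl mul1r => H1 H2.
  apply: le_trans (ler_distD (t (b + j)%N) _ _) _.
  by rewrite addrC lerD.
have tk : `|t k - t b| <= 2 * K * window_step_bound * h.
  have xkK : x k <= K by apply: le_trans (ler_norm _) xK.
  have := tj (k - b)%N; rewrite subnKC// => /(_ xkK) /le_trans; apply.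
  have jh : (k - b)%:R * h <= 2 * K.
    have := xD b (k - b); rewrite subnKC// => xE.
    have : - K <= x b by rewrite -bP.
    by lra.
  have -> : (k - b)%:R * (window_step_bound * h ^+ 2) =
    ((k - b)%:R * h) * (window_step_bound * h) by ring.
  rewrite -[leRHS]mulrA ler_wpM2r//.
  by apply: mulr_ge0 step_ge0 _; exact: ltW.
pose r := sg ^+ 2 * a k - S k.
have rC : `|r| <= C := stein_seq_approx ss k.
have aE : a k = h * (S k * h) + r * h ^+ 2.
  have -> : h * (S k * h) + r * h ^+ 2 = (sg * h) ^+ 2 * a k by rewrite /r; ring.
  by rewrite sgh expr1n mul1r.
have gE : t b * Num.sqrt (pi *+ 2) * gauss (x k) = t b * expR (- (x k ^+ 2 / 2)).
  by rewrite /gauss mulNr mulrA mulfK.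
have uE : S k * h = t k * expR (- (x k ^+ 2 / 2)).
  by rewrite /t -mulrA -expRD subrr expR0 mulr1.
rewrite aE gE uE addrAC -mulrBr -mulrBl.
apply: le_trans (ler_normD _ _) _; rewrite (normrM r) (normrM h) (normrM (t k - t b)).
rewrite [`|h ^+ 2|]ger0_norm ?sqr_ge0// [`|h|]gtr0_norm// [`|expR _|]ger0_norm ?expR_ge0//.
have e1 : expR (- (x k ^+ 2 / 2)) <= 1.
  by rewrite -[leRHS]expR0 ler_expR oppr_le0 divr_ge0 ?sqr_ge0.
have p1 : h * (`|t k - t b| * expR (- (x k ^+ 2 / 2))) <= h * (2 * K * window_step_bound * h).
  rewrite ler_pM2l//; apply: le_trans tk; rewrite -[leRHS]mulr1.
  by rewrite ler_wpM2l.
have p2 : `|r| * h ^+ 2 <= C * h ^+ 2 by rewrite ler_wpM2r ?sqr_ge0.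
have p3 : 0 <= Num.sqrt (pi *+ 2) * expR (K ^+ 2 / 2) * h ^+ 2.
  by apply: mulr_ge0 (sqr_ge0 h); rewrite mulr_ge0 ?sqrtr_ge0 ?expR_ge0.
have -> : window_bound * h ^+ 2 = h * (2 * K * window_step_bound * h) + C * h ^+ 2 +
    Num.sqrt (pi *+ 2) * expR (K ^+ 2 / 2) * h ^+ 2 by rewrite /window_bound; ring.
lra.
Qed.

End Window.

(** * Determination of the constant, and the central and local estimates for one law *)

Section CentralWindow.
Variables (R : realType) (C : R) (N : nat) (a S : nat -> R) (mu sg : R).
Hypothesis ss : stein_sequence C N a S mu sg.
Variables K d : R.
Hypotheses (K1 : 1 <= K) (Ksg : K <= sg).
Hypothesis Phi_d : forall y : R, (K <= y -> 1 - d <= Phi y) /\ (y <= - K -> Phi y <= d).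

Let h := sg^-1.
Let x (k : nat) : R := (k%:R - mu) * h.
Let E := window_bound C K.
Let F m := \sum_(k < m) a k.

(** An error [2 E h^2] per step over at most [(2 K + 1) / h] steps, divided by [h]. *)
Definition window_error := 2 * E * (2 * K + 1).
(** In order: the two Gaussian tails, the rounding at the left end of the window, Chebyshev on both
    sides, and the sum over the window. *)
Definition central_error := 2 * d + h + 2 / K ^+ 2 + window_error * h.

Let sg0 : 0 < sg. Proof. by have k1 := K1; have ks := Ksg; lra. Qed.
Let h0 : 0 < h. Proof. by rewrite invr_gt0 sg0. Qed.
Let sgh : sg * h = 1. Proof. by rewrite divff// gt_eqF// sg0. Qed.
Let Kh : K * h <= 1. Proof. by rewrite -sgh ler_pM2r// Ksg. Qed.
Let h1 : h <= 1.
Proof. by have kh := Kh; have k1 := K1; have hp := h0; nra. Qed.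
Let E0 : 0 <= E. Proof. exact: (window_bound_ge0 ss K1). Qed.
Let K2 : 0 < K ^- 2.
Proof. by rewrite invr_gt0 exprn_gt0//; have k1 := K1; lra. Qed.

Let xS k : x k.+1 = x k + h.
Proof. by rewrite /x -natr1; ring. Qed.

Let xD k j : x (k + j) = x k + j%:R * h.
Proof. by rewrite /x natrD; ring. Qed.

Let x_lt k m : (x k < x m) = (k < m)%N.
Proof. by rewrite /x ltr_pM2r// ltrD2r ltr_nat. Qed.

Let x0 : x 0 <= - K.
Proof.
rewrite /x sub0r mulNr lerN2; apply: le_trans Ksg _.
rewrite ler_pdivlMr ?sg0// -expr2; exact: stein_seq_mean ss.
Qed.

Let F_homo k m : (k <= m)%N -> F k <= F m.
Proof.
move=> km; rewrite /F -(subnKC km) big_split_ord/= lerDl sumr_ge0// => i _.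
exact: stein_seq_ge0 ss _.
Qed.

Let sum_lt m : \sum_(k < N | (k < m)%N) a k = F m.
Proof.
rewrite /F; have [mN|/ltnW Nm] := leqP m N; first by rewrite (big_ord_widen _ _ mN).
have -> : \sum_(k < m) a k = \sum_(k < N + (m - N)) a k by rewrite subnKC.
rewrite big_split_ord/= [X in _ = _ + X]big1 ?addr0; last first.
  by move=> i _; rewrite (stein_seq_end ss)// leq_addr.
by apply: eq_bigl => i; rewrite (leq_trans (ltn_ord i)).
Qed.

Let F_le1 m : F m <= 1.
Proof.
rewrite -sum_lt -(stein_seq_sum ss) [leRHS](bigID (fun k : 'I_N => (k < m)%N))/=.
by rewrite lerDl sumr_ge0// => i _; exact: stein_seq_ge0 ss _.
Qed.

Let start : exists b, (forall k, (b <= k)%N = (- K <= x k)) /\ x b <= - K + h.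
Proof. exact: (window_start ss K1 Ksg). Qed.

Let local : exists B, 0 <= B <= E /\
  forall k, `|x k| <= K -> `|a k - h * (B * gauss (x k))| <= E * h ^+ 2.
Proof. exact: (local_estimate ss K1 Ksg). Qed.

Lemma stein_seq_chebyshev (P : pred nat) : (forall k, P k -> K <= `|x k|) ->
  \sum_(k < N | P k) a k <= K ^- 2.
Proof.
move=> PK; have k1 := K1; have Kp : 0 < K ^+ 2 by rewrite exprn_gt0//; lra.
rewrite -[leRHS]mul1r ler_pdivlMr// mulr_suml.
have -> : 1 = \sum_(k < N) a k * x k ^+ 2.
  have -> : \sum_(k < N) a k * x k ^+ 2 =
      h ^+ 2 * \sum_(k < N) (k%:R - mu) ^+ 2 * a k.
    by rewrite mulr_sumr; apply: eq_bigr => k _; rewrite /x; ring.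
  by rewrite (stein_seq_var ss) -exprMn mulrC sgh expr1n.
rewrite [leRHS](bigID (fun k : 'I_N => P k))/= -[leLHS]addr0 lerD//; last first.
  by rewrite sumr_ge0// => i _; rewrite mulr_ge0 ?sqr_ge0//; exact: stein_seq_ge0 ss _.
rewrite ler_sum// => i /PK Ki; rewrite ler_wpM2l//; first exact: stein_seq_ge0 ss _.
rewrite -[leRHS]real_normK ?num_real// lerXn2r ?nnegrE//; lra.
Qed.

(** [m] is the number of indices with [x k <= y], which turns the distribution function at [y] into
    the partial sum [F m]. *)
Lemma first_above y : exists m, (forall k, (m <= k)%N = (y < x k)) /\
  (- K <= y -> x m <= y + h).
Proof.
have exm : exists k, y < x k.
  exists (Num.truncn (mu + `|y| * sg)).+1; rewrite /x.
  apply: le_lt_trans (ler_norm y) _.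
  by rewrite ltr_pdivlMr ?sg0// ltrBrDl truncnS_gt.
case: (ex_minnP exm) => m ym mmin; exists m; split.
  move=> k; apply/idP/idP; last exact: mmin.
  by move=> mk; apply: lt_le_trans ym _; rewrite leNgt x_lt -leqNgt.
case: m ym mmin => [y0 _ Ky|m ym mmin _].
  by have xx := x0; have hp := h0; lra.
rewrite xS lerD2r; have [//|/mmin] := leP (x m) y.
by rewrite ltnn.
Qed.

(** A Riemann sum: at each step [a k] is compared with [B] times the increment of [Phi], at a cost
    of [E h^2] for the local estimate and [B h^2 <= E h^2] for [Phi_step]. *)
Lemma window_sum b B m : - K <= x b -> 0 <= B <= E ->
  (forall k, `|x k| <= K -> `|a k - h * (B * gauss (x k))| <= E * h ^+ 2) ->
  (b <= m)%N -> x m <= K + h ->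
  `|F m - F b - B * (Phi (x m) - Phi (x b))| <= window_error * h.
Proof.
move=> bK /andP[B0 BE] loc bm xm.
have step j : x (b + j)%N <= K + h ->
    `|F (b + j)%N - F b - B * (Phi (x (b + j)%N) - Phi (x b))| <= j%:R * (2 * E * h ^+ 2).
  elim: j => [|j IHj] xj; first by rewrite addn0 !subrr mulr0 subrr normr0 mul0r.
  move: xj; rewrite addnS xS => xj.
  have xjK : x (b + j)%N <= K by lra.
  have {IHj} := IHj (le_trans xjK (_ : K <= K + h)); rewrite lerDl ltW// => /(_ isT) IHj.
  have xj' : `|x (b + j)%N| <= K.
    rewrite ler_norml xjK andbT (le_trans bK)// xD lerDl mulr_ge0// ltW//.
  have := loc _ xj'; have := Phi_step (x (b + j)%N) (ltW h0).
  set k := (b + j)%N in xj xjK xj' IHj *; set g := gauss (x k).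
  set p := Phi (x k + h) - Phi (x k) - h * g => Hp Ha.
  have -> : F k.+1 - F b - B * (Phi (x k + h) - Phi (x b)) =
      (F k - F b - B * (Phi (x k) - Phi (x b))) + ((a k - h * (B * g)) - B * p).
    by rewrite /F big_ord_recr/= /p; ring.
  have Bp : `|B * p| <= E * h ^+ 2 by rewrite normrM (ger0_norm B0) ler_pM.
  apply: le_trans (ler_normD _ _) _; rewrite -natr1 mulrDl lerD// mul1r.
  by apply: le_trans (ler_normB _ _) _; lra.
have := step (m - b)%N; rewrite subnKC// => /(_ xm) /le_trans; apply.
have jh : (m - b)%:R * h <= 2 * K + 1.
  have := xD b (m - b); rewrite subnKC// => xE.
  by have hh := h1; lra.
have -> : (m - b)%:R * (2 * E * h ^+ 2) = ((m - b)%:R * h) * (2 * E * h) by ring.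
have -> : window_error * h = (2 * K + 1) * (2 * E * h) by rewrite /window_error; ring.
by rewrite ler_wpM2r// mulr_ge0 ?(ltW h0)// mulr_ge0.
Qed.

Hypothesis small : central_error <= 3^-1.

Let d0 : 0 <= d.
Proof. by have [_ /(_ (lexx _))] := Phi_d (- K); apply: le_trans; exact: Phi_ge0. Qed.

Let We0 : 0 <= window_error * h.
Proof.
have k1 := K1; apply: mulr_ge0 (ltW h0).
by apply: mulr_ge0; [rewrite mulr_ge0|lra].
Qed.

Let err0 : 0 <= central_error.
Proof.
have dd := d0; have hh := h0; have kk := K2; have ww := We0.
by rewrite /central_error; lra.
Qed.

Let F_left b : (forall k, (b <= k)%N = (- K <= x k)) -> F b <= K ^- 2.
Proof.
move=> bP; rewrite -sum_lt; apply: (stein_seq_chebyshev (P := fun k => (k < b)%N)).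
move=> k; rewrite ltnNge bP -ltNge => xk.
by have := ler_norm (- x k); rewrite normrN; lra.
Qed.

Let F_right M : (forall k, (M <= k)%N = (K < x k)) -> 1 - K ^- 2 <= F M.
Proof.
move=> MP; rewrite lerBlDr -lerBlDl -sum_lt -(stein_seq_sum ss).
rewrite [X in X - _](bigID (fun k : 'I_N => (k < M)%N))/= addrAC subrr add0r.
apply: (stein_seq_chebyshev (P := fun k => ~~ (k < M)%N)).
by move=> k; rewrite -leqNgt MP => /ltW/le_trans; apply; exact: ler_norm.
Qed.

(* The window carries mass almost [1], and mass almost [B]. *)
Lemma central_constant b B : (forall k, (b <= k)%N = (- K <= x k)) -> x b <= - K + h ->
  0 <= B <= E ->
  (forall k, `|x k| <= K -> `|a k - h * (B * gauss (x k))| <= E * h ^+ 2) ->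
  `|B - 1| <= 3 * central_error.
Proof.
move=> bP xb BE loc; have /andP[B0 _] := BE.
have [M [MP xM]] := first_above K.
have k1 := K1; have hp := h0.
have bM : (b <= M)%N.
  have KM : K < x M by rewrite -MP.
  by rewrite bP; lra.
have xbK : - K <= x b by rewrite -bP.
have {}xM : x M <= K + h by apply: xM; lra.
have W := window_sum xbK BE loc bM xM.
have FM := F_right MP; have Fb := F_left bP; have FM1 := F_le1 M.
have Fb0 : 0 <= F b by rewrite sumr_ge0// => i _; exact: stein_seq_ge0 ss _.
have PM : 1 - d <= Phi (x M) by have [+ _] := Phi_d (x M); apply; rewrite ltW// -MP.
have Pb : Phi (x b) <= d + h.
  have [_ /(_ (lexx _)) PK] := Phi_d (- K).
  have := Phi_lipschitz (x b) (- K); rewrite [X in _ <= X]ger0_norm ?subr_ge0//.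
  by have := ler_norm (Phi (x b) - Phi (- K)); lra.
have Pb0 := Phi_ge0 (x b); have PM1 := Phi_le1 (x M).
have err := err0; have sm := small; have ww := We0; have kk := K2.
set D := Phi (x M) - Phi (x b) in W.
have D1 : D <= 1 by rewrite /D; lra.
have D2 : 1 - central_error <= D by rewrite /central_error /D; lra.
have BD : 1 - central_error <= B * D <= 1 + central_error.
  by move: W; rewrite /central_error ler_norml => /andP[W1 W2]; have dd := d0; lra.
move: BD => /andP[BD1 BD2].
set e := central_error in err sm D2 BD1 BD2 *.
have BB : B * D <= B by rewrite ler_piMr.
rewrite ler_norml; apply/andP; split; first lra.
(* This is where [small] enters: for [e <= 1 / 3], [(1 + 3 e) (1 - e) >= 1 + e], which contradicts
   [B (1 - e) <= B D <= 1 + e]. *)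
rewrite leNgt; apply/negP => Be.
have B1 : 1 + 3 * e < B by lra.
have : B * (1 - e) <= 1 + e by apply: le_trans BD2; rewrite ler_wpM2l.
have : (1 + 3 * e) * (1 - e) < B * (1 - e) by rewrite ltr_pM2r//; lra.
by nra.
Qed.

(** Left of the window both quantities are near [0], right of it both are near [1]; inside,
    [window_sum] applies with [B] near [1]. *)
Lemma clt_estimate y :
  `| \sum_(k < N | k%:R <= mu + y * sg) a k - Phi y | <= 6 * central_error.
Proof.
have [m [mP xm]] := first_above y.
have -> : \sum_(k < N | k%:R <= mu + y * sg) a k = F m.
  rewrite -sum_lt; apply: eq_bigl => k; rewrite ltnNge mP -leNgt /x.
  by rewrite ler_pdivrMr ?sg0// lerBlDl.
have k1 := K1; have hp := h0; have err := err0; have ww := We0; have kk := K2; have dd := d0.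
have [b [bP xb]] := start.
have Fb := F_left bP.
have Fm0 : 0 <= F m by rewrite sumr_ge0// => i _; exact: stein_seq_ge0 ss _.
have Fm1 := F_le1 m; have P0 := Phi_ge0 y; have P1 := Phi_le1 y.
have [yK|Ky] := ltP y (- K).
  have mb : (m <= b)%N.
    by rewrite mP (lt_le_trans yK)// -bP.
  have Fm := F_homo mb; have [_ /(_ (ltW yK)) Py] := Phi_d y.
  by rewrite ler_norml /central_error; lra.
have {}xm := xm Ky.
have ym : y < x m by rewrite -mP.
have bm : (b <= m)%N by rewrite bP; lra.
have Fbm := F_homo bm.
have [Ky'|yK] := ltP K y.
  have [M [MP _]] := first_above K.
  have Mm : (M <= m)%N by rewrite MP; lra.
  have FM := F_right MP; have FMm := F_homo Mm.
  have [/(_ (ltW Ky')) Py _] := Phi_d y.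
  by rewrite ler_norml /central_error; lra.
have [B [BE loc]] := local.
have xbK : - K <= x b by rewrite -bP.
have xmK : x m <= K + h by lra.
have W := window_sum xbK BE loc bm xmK.
have B1 := central_constant bP xb BE loc.
have Fb0 : 0 <= F b by rewrite sumr_ge0// => i _; exact: stein_seq_ge0 ss _.
have Pb : Phi (x b) <= d + h.
  have [_ /(_ (lexx _)) PK] := Phi_d (- K).
  have := Phi_lipschitz (x b) (- K); rewrite [X in _ <= X]ger0_norm ?subr_ge0//.
  by have := ler_norm (Phi (x b) - Phi (- K)); lra.
have Pb0 := Phi_ge0 (x b).
have Pm : `|Phi (x m) - Phi y| <= h.
  by apply: le_trans (Phi_lipschitz _ _) _; rewrite ger0_norm; lra.
set D := Phi (x m) - Phi (x b) in W.
have D0 : 0 <= D by rewrite subr_ge0 Phi_homo// /x leNgt x_lt -leqNgt.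
have D1 : D <= 1 by have := Phi_le1 (x m); rewrite /D; lra.
have BD : `|B * D - D| <= 3 * central_error.
  have -> : B * D - D = (B - 1) * D by ring.
  by rewrite normrM (ger0_norm D0) -[leRHS]mulr1 ler_pM.
move: W BD Pm; rewrite !ler_norml /D /central_error => /andP[W1 W2] /andP[? ?] /andP[? ?].
by apply/andP; split; lra.
Qed.

Lemma llt_estimate y :
  `| sg * (let z := Num.floor (mu + y * sg) in if 0 <= z then a `|z|%N else 0)
     - gauss y | <= 3 * central_error + (E + 2) * h + (C + 1) / K.
Proof.
have k1 := K1; have hp := h0; have err := err0; have Ep := E0.
have K0 : 0 < K by lra.
have C0 : 0 <= C := le_trans (normr_ge0 _) (stein_seq_tail ss 0).
have CK : 0 <= C / K by rewrite divr_ge0// ltW.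
have K10 : 0 < K^-1 by rewrite invr_gt0.
have Eh : 0 <= E * h by rewrite mulr_ge0// ltW.
have -> : (E + 2) * h = E * h + 2 * h by ring.
have -> : (C + 1) / K = C / K + K^-1 by rewrite mulrDl mul1r.
set z := Num.floor _.
have zy : z%:~R <= mu + y * sg by exact: floor_le.
have yz : mu + y * sg < z%:~R + 1 by rewrite -intrD1 floorD1_gt.
pose w := (z%:~R - mu) * h.
have wy : w <= y by rewrite ler_pdivrMr ?sg0// lerBlDl.
have yw : y < w + h.
  have -> : w + h = (z%:~R + 1 - mu) * h by rewrite /w; ring.
  by rewrite ltr_pdivlMr ?sg0// ltrBrDl.
have gyw : `|gauss w - gauss y| <= h.
  by apply: le_trans (gauss_lipschitz _ _) _; rewrite ler0_norm; lra.
have gtail : K <= `|w| -> 0 <= gauss w <= K^-1.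
  move=> Kw; rewrite ltW ?gauss_gt0//=.
  have -> : gauss w = gauss `|w| by rewrite /gauss real_normK// num_real.
  apply: le_trans (gauss_le _) _; first lra.
  by rewrite lef_pV2 ?posrE//; lra.
rewrite /=; case: ifP => [z0|/negbT]; last first.
  (* A negative [z] has mass [0], and [w <= x 0 <= - K] makes the density small as well. *)
  rewrite -ltNge => z0; rewrite mulr0 sub0r normrN.
  have zN1 : z%:~R <= -1 :> R by rewrite -[-1]/((-1)%:~R) ler_int -[-1]sub0r lerBrDr lezD1.
  have w0 : w <= x 0.
    by rewrite /w /x ler_pM2r// lerD2r; lra.
  have Kw : K <= `|w| by have := ler_norm (- w); rewrite normrN; have xx := x0; lra.
  have /andP[g0 gK] := gtail Kw.
  by move: gyw; rewrite !ler_norml => /andP[? ?]; apply/andP; split; lra.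
set k := `|z|%N.
have zk : z%:~R = k%:R :> R by rewrite /k -{1}(gez0_abs z0).
have wx : w = x k by rewrite /w zk.
have [wK|Kw] := leP `|w| K.
  have [B [BE loc]] := local.
  have [b [bP xb]] := start.
  have B1 := central_constant bP xb BE loc.
  have := loc k; rewrite -/(x k) -wx => /(_ wK) L.
  have L' : `|sg * a k - B * gauss w| <= E * h.
    have -> : sg * a k - B * gauss w = sg * (a k - h * (B * gauss w)).
      have -> : sg * (a k - h * (B * gauss w)) = sg * a k - (sg * h) * (B * gauss w) by ring.
      by rewrite sgh mul1r.
    rewrite normrM (gtr0_norm sg0).
    have -> : E * h = sg * (E * h ^+ 2).
      have -> : sg * (E * h ^+ 2) = (sg * h) * (E * h) by ring.
      by rewrite sgh mul1r.
    by rewrite ler_pM2l.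
  have Bg : `|B * gauss w - gauss w| <= 3 * central_error.
    have -> : B * gauss w - gauss w = (B - 1) * gauss w by ring.
    have /andP[g0 g1] := gauss_itv01 w.
    by rewrite normrM (ger0_norm g0) -[leRHS]mulr1 ler_pM.
  move: L' Bg gyw; rewrite !ler_norml => /andP[? ?] /andP[? ?] /andP[? ?].
  by apply/andP; split; lra.
(* Outside the window, [|w| * (sg * a k) = |k - mu| * a k <= C] and [|w| > K]. *)
have sa0 : 0 <= sg * a k by rewrite mulr_ge0 ?(ltW sg0)//; exact: stein_seq_ge0 ss _.
have sa : sg * a k <= C / K.
  rewrite ler_pdivlMr//; apply: le_trans (stein_seq_tail ss k).
  have -> : (k%:R - mu) * a k = w * (sg * a k).
    rewrite wx /x.
    have -> : (k%:R - mu) * h * (sg * a k) = (k%:R - mu) * a k * (sg * h) by ring.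
    by rewrite sgh mulr1.
  by rewrite normrM (ger0_norm sa0) mulrC ler_wpM2r// ltW.
have /andP[g0 gK] := gtail (ltW Kw).
by move: gyw; rewrite !ler_norml => /andP[? ?]; apply/andP; split; lra.
Qed.

End CentralWindow.

(** * Uniform limit theorem as the standard deviation grows *)

Lemma stein_limit (R : realType) (C eps : R) : 0 <= C -> 0 < eps ->
  exists s0 : R, forall N (a S : nat -> R) (mu sg : R),
    stein_sequence C N a S mu sg -> s0 <= sg ->
    (forall y, `| \sum_(k < N | k%:R <= mu + y * sg) a k - Phi y | <= eps) /\
    (forall y, `| sg * (let z := Num.floor (mu + y * sg) in
                          if 0 <= z then a `|z|%N else 0) - gauss y | <= eps).
Proof.
(* Below, [central_error] is at most [6 e]: the central bound becomes [36 e <= eps], the local one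
   [20 e], and [6 e <= 1 / 3] meets the condition [small]. *)
move=> C0 eps0; pose e := Num.min eps 1 / 40.
have m0 : 0 < Num.min eps 1 by rewrite lt_min eps0 ltr01.
have meps : Num.min eps 1 <= eps by rewrite ge_min lexx.
have m1 : Num.min eps 1 <= 1 by rewrite ge_min lexx orbT.
have e0 : 0 < e by rewrite /e; lra.
have e1 : e <= 1 by rewrite /e; lra.
have e36 : 36 * e <= eps by rewrite /e; lra.
have e6 : 6 * e <= 3^-1 by rewrite /e; lra.
have [K0 [_ PhiK]] := Phi_tails e0.
pose K := Num.max K0 ((C + 1) / e).
have KK0 : K0 <= K by rewrite le_max lexx.
have KC : (C + 1) / e <= K by rewrite le_max lexx orbT.
have K1 : 1 <= K.
  by apply: le_trans KC; rewrite ler_pdivlMr//; lra.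
have Kp : 0 < K by lra.
have CK : (C + 1) / K <= e by rewrite ler_pdivrMr// mulrC -ler_pdivrMr.
have K2 : 2 / K ^+ 2 <= 2 * e.
  rewrite ler_pM2l//; have : K^-1 <= e.
    by apply: le_trans CK; rewrite -[leLHS]mul1r ler_wpM2r ?invr_ge0 ?(ltW Kp)//; lra.
  apply: le_trans; rewrite lef_pV2 ?posrE ?exprn_gt0//.
  by rewrite expr2 ler_peMl// ltW.
have Phid y : (K <= y -> 1 - e <= Phi y) /\ (y <= - K -> Phi y <= e).
  by have [h1 h2] := PhiK y; split => Ky; [apply: h1|apply: h2]; lra.
(* Chosen before any law is given; the maximum with [0] makes nonnegativity immediate. *)
pose W := Num.max 0 (window_error C K); pose E := Num.max 0 (window_bound C K).
have W0 : 0 <= W by rewrite le_max lexx.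
have E0 : 0 <= E by rewrite le_max lexx.
have WW : window_error C K <= W by rewrite le_max lexx orbT.
have EE : window_bound C K <= E by rewrite le_max lexx orbT.
exists (Num.max K ((W + E + 2) / e)) => N a S mu sg ss; rewrite ge_max => /andP[Ksg sge].
have sg0 : 0 < sg by lra.
have h0 : 0 < sg^-1 by rewrite invr_gt0.
have hWE : W * sg^-1 + E * sg^-1 + 2 * sg^-1 <= e.
  by rewrite -!mulrDl ler_pdivrMr// mulrC -ler_pdivrMr.
have Wh : 0 <= W * sg^-1 by rewrite mulr_ge0// ltW.
have Eh : 0 <= E * sg^-1 by rewrite mulr_ge0// ltW.
have WWh : window_error C K * sg^-1 <= W * sg^-1 by rewrite ler_pM2r.
have EEh : window_bound C K * sg^-1 <= E * sg^-1 by rewrite ler_pM2r.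
have EEh2 : (window_bound C K + 2) * sg^-1 <= E * sg^-1 + 2 * sg^-1.
  by rewrite mulrDl lerD2r.
have ce : central_error C sg K e <= 6 * e by rewrite /central_error; lra.
have ce3 : central_error C sg K e <= 3^-1 by lra.
split=> y.
  by apply: le_trans (clt_estimate ss K1 Ksg Phid ce3 y) _; lra.
by apply: le_trans (llt_estimate ss K1 Ksg Phid ce3 y) _; lra.
Qed.

(** * Application to Laplacian coefficients *)

Lemma pbin_stein_sequence (R : realType) (s : seq R) : prob_seq s -> 2 <= pbin_var s ->
  stein_sequence 128 (size s).+1 (fun k => (pbin_poly s)`_k) (stein s)
    (pbin_mean s) (Num.sqrt (pbin_var s)).
Proof.
move=> sP V2; have V0 : 0 <= pbin_var s by lra.
split; rewrite ?sqr_sqrtr//.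
- by move=> k; exact: pbin_ge0.
- by move=> k sk; rewrite nth_default// (leq_trans (size_pbin s)).
- exact: sum_pbin.
- exact: pbin_var_sum.
- exact: steinE.
- by move=> k; rewrite stein_ge0// stein_le.
- by move=> k; exact: stein_approx.
- by move=> k; apply: le_trans (pbin_tail_le _ sP V2) _; lra.
- exact: pbin_var_le_mean.
Qed.

(* An eigenvalue [l] contributes the factor [(X + l) / (1 + l)] to the
   normalized polynomial, a Bernoulli law of parameter [1 / (1 + l)]. *)
Lemma laplacian_pbin (R : realType) (G : sgraph) : exists s : seq R,
  [/\ size s = nv G, prob_seq s,
    (nedges G)%:R / (1 + 2 * (maxdeg G)%:R) ^+ 2 <= pbin_var s &
    forall k, lapcoef R G k / (\sum_(j < (nv G).+1) lapcoef R G j) = (pbin_poly s)`_k].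
Proof.
have [ls [charE lsP]] := laplacian_spectrum G R.
have sls : size ls = nv G.
  by apply: succn_inj; rewrite -(size_char_poly (laplacian R G)) charE size_prod_XsubC.
have l0 l : l \in ls -> 0 <= l by move=> /(allP lsP)/andP[].
exists [seq (1 + l)^-1 | l <- ls]; split.
- by rewrite size_map.
- apply/allP => _ /mapP[l /l0 l0' ->].
  by rewrite invr_ge0 addr_ge0//= invf_le1; lra.
- rewrite /pbin_var big_map ler_pdivrMr; last first.
    by rewrite exprn_gt0// ltr_pwDl// mulr_ge0.
  (* The trace is at least the number of edges, and each variance [l / (1 + l)^2] is at least
     [l / (1 + 2 Delta)^2]. *)
  apply: (@le_trans _ _ (\sum_(l <- ls) l)).
    by rewrite (sum_spectrum charE) -natr_sum ler_nat nedges_le_sum_deg.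
  rewrite big_distrl/= big_seq [leRHS]big_seq ler_sum// => l lls.
  have /andP[l0' lD] := allP lsP l lls.
  have [L LD] : 0 < 1 + l /\ 1 + l <= 1 + 2 * (maxdeg G)%:R by split; lra.
  have -> : (1 + l)^-1 * (1 - (1 + l)^-1) * (1 + 2 * (maxdeg G)%:R) ^+ 2 =
      l * ((1 + 2 * (maxdeg G)%:R) ^+ 2 / (1 + l) ^+ 2) by field; exact: lt0r_neq0.
  rewrite ler_peMr// ler_pdivlMr ?exprn_gt0// mul1r.
  by rewrite lerXn2r// nnegrE ?(le_trans (ltW L) LD)// ltW.
move=> k.
pose Q := \prod_(l <- ls) ('X + l%:P).
have lE j : lapcoef R G j = Q`_j by rewrite /lapcoef charE -sls coef_prod_XaddC.
pose Z := \prod_(l <- ls) (1 + l).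
have Q1 : \sum_(j < (nv G).+1) lapcoef R G j = Z.
  under eq_bigr do rewrite lE.
  have sQ : (size Q <= (nv G).+1)%N.
    have -> : Q = \prod_(l <- [seq - l | l <- ls]) ('X - l%:P).
      by rewrite big_map; apply: eq_bigr => l _; rewrite polyCN opprK.
    by rewrite size_prod_XsubC size_map sls.
  have -> : Z = Q.[1].
    by rewrite horner_prod; apply: eq_bigr => l _; rewrite !hornerE.
  by rewrite (horner_coef_wide _ sQ); apply: eq_bigr => j _; rewrite expr1n mulr1.
have -> : pbin_poly [seq (1 + l)^-1 | l <- ls] = Z^-1 *: Q.
  rewrite /pbin_poly big_map /Z /Q -prodfV -scaler_prod.
  rewrite big_seq [RHS]big_seq; apply: eq_bigr => l /l0 l0'.
  have L : 1 + l != 0 by rewrite gt_eqF//; lra.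
  rewrite /bernoulli_poly scalerDr -!mul_polyC -polyC1 -polyCB -polyCM addrC.
  by congr (_ + _%:P); field.
by rewrite coefZ lE Q1 mulrC.
Qed.

Lemma nedges_ge_index (G : nat -> sgraph) :
  (forall n, (nedges (G n) < nedges (G n.+1))%N) -> forall n, (n <= nedges (G n))%N.
Proof. by move=> Gi; elim=> // n IHn; exact: leq_ltn_trans IHn (Gi n). Qed.

Lemma edge_ratio_large (R : realType) (G : nat -> sgraph) (A : R) :
  (forall n, (nedges (G n) < nedges (G n.+1))%N) ->
  ((fun n => ((maxdeg (G n)) ^ 2)%:R / (nedges (G n))%:R : R) @ \oo --> 0) ->
  \forall n \near \oo, A <= (nedges (G n))%:R / (1 + 2 * (maxdeg (G n))%:R) ^+ 2.
Proof.
move=> Gi Gd; pose B := Num.max A 1.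
have B1 : 1 <= B by rewrite le_max lexx orbT.
have AB : A <= B by rewrite le_max lexx.
(* [10 = 2 + 8]: since [(1 + 2 D)^2 <= 2 + 8 D^2], the bounds [10 B <= M] and [10 B D^2 <= M] add up
   to [B (1 + 2 D)^2 <= M]. *)
pose e := (10 * B)^-1; have e0 : 0 < e by rewrite invr_gt0; lra.
move/cvgrPdist_le : Gd => /(_ e e0) Gd.
near=> n.
apply: le_trans AB _.
have En : 10 * B <= (nedges (G n))%:R.
  apply: (@le_trans _ _ n%:R); last by rewrite ler_nat nedges_ge_index.
  by near: n; exact: nbhs_infty_ger.
have E0 : 0 < (nedges (G n))%:R :> R by lra.
have : `|0 - ((maxdeg (G n)) ^ 2)%:R / (nedges (G n))%:R| <= e by near: n; exact: Gd.
rewrite sub0r normrN ger0_norm ?divr_ge0// ler_pdivrMr// natrX /e mulrC.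
rewrite ler_pdivlMr; last lra.
set D : R := (maxdeg (G n))%:R; set M : R := (nedges (G n))%:R in En E0 *.
move=> DM; have D0 : 0 <= D by exact: ler0n.
rewrite ler_pdivlMr; last by rewrite exprn_gt0//; lra.
have D2 : (1 + 2 * D) ^+ 2 <= 2 + 8 * D ^+ 2 by have := sqr_ge0 (1 - 2 * D); rewrite !expr2; nra.
apply: le_trans (ler_wpM2l _ D2) _; first lra.
lra.
Unshelve. all: by end_near. Qed.



Theorem theorem2p3 (R : realType) (G : nat -> sgraph) :
  (forall n, (nedges (G n) < nedges (G n.+1))%N) ->
  ((fun n => ((maxdeg (G n)) ^ 2)%:R / (nedges (G n))%:R : R) @ \oo --> 0) ->
  clt_normal R G /\ llt_normal R G.
Proof.
move=> Gi Gd.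
have lim eps : 0 < eps -> \forall n \near \oo,
    (forall y : R, `| \sum_(k < (nv (G n)).+1 | k%:R <= mu R G n + y * sigma R G n)
        pnk R G n k - Phi y | <= eps) /\
    (forall y : R, `| sigma R G n * pnz R G n (Num.floor (mu R G n + y * sigma R G n))
       - gauss y | <= eps).
  move=> eps0; have [s0 lim_s0] := stein_limit (ler0n R 128) eps0.
  (* The [2] meets the condition of [pbin_stein_sequence], and the square ensures [s0 <= sqrt V]
     whatever the sign of [s0]. *)
  have large := edge_ratio_large (2 + s0 ^+ 2) Gi Gd.
  near=> n.
  have [s [ss sP sV pE]] := laplacian_pbin R (G n).
  have V2 : 2 + s0 ^+ 2 <= pbin_var s by apply: le_trans sV; near: n.
  have pnkE : pnk R G n = fun k => (pbin_poly s)`_k by apply/funext.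
  have muE : mu R G n = pbin_mean s.
    by rewrite -pbin_mean_sum ss /mu pnkE.
  have sigmaE : sigma R G n = Num.sqrt (pbin_var s).
    by rewrite -pbin_var_sum ss /sigma /sigma2 muE pnkE.
  have s02 := sqr_ge0 s0.
  rewrite /pnz pnkE muE sigmaE -ss.
  apply: lim_s0; first by apply: pbin_stein_sequence => //; lra.
  apply: le_trans (ler_norm s0) _.
  by rewrite -sqrtr_sqr ler_wsqrtr//; lra.
by split=> eps eps0; apply: filterS (lim eps eps0) => n [].
Unshelve. all: by end_near. Qed.
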